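(* Let $K/k$ be a finite Galois extension of number fields with group $G=\mathrm{Gal}(K/k)$, let $p$ be a prime number, and let $K^+$ be the subfield of $K$ fixed by a central subgroup of $G$ of order $p$. Let $\mathbf{T}$ be the associated algebraic torus over $k$, $$\mathbf{T}=\mathrm{Ker}\left(\mathbb{G}_m\times_{\mathrm{Spec}(k)}\mathbf{R}_{K/k}(\mathbb{G}_m)\xrightarrow{(x,y)\mapsto x^{-1}N_{K/K^+}(y)}\mathbf{R}_{K^+/k}(\mathbb{G}_m)\right),$$ with character lattice $\mathbf{X}^\star(\mathbf{T})$. Then $\hat H^1(k,\mathbf{X}^\star(\mathbf{T}))$ is trivial when the $p$-Sylow subgroups of $G$ are cyclic, and is isomorphic to $\mathbb{Z}/p\mathbb{Z}$ otherwise.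
   Context: $\mathbf{R}_{E/k}$ denotes Weil restriction of scalars from $E$ to $k$. The torus $\mathbf{T}$ is split over $K$, so $\mathbf{X}^\star(\mathbf{T})$ is a $G$-module, and $\hat H^1(k,\mathbf{X}^\star(\mathbf{T}))$ means the Tate cohomology group $\hat H^1(G,\mathbf{X}^\star(\mathbf{T}))$. *)

(* Defs.v *)
From HB Require Import structures.
From mathcomp Require Import all_boot all_order all_algebra.
From mathcomp Require Import all_fingroup all_solvable all_field.
From mathcomp Require Import boolp.

Set Implicit Arguments.
Unset Strict Implicit.
Unset Printing Implicit Defensive.

Import GRing.Theory GroupScope.
Local Open Scope ring_scope.

(* A commutative k-algebra is a commutative ring (possibly the zero ring)     *)
(* with a structure morphism.  The structure morphism is a field of a record, *)
(* rather than a canonical structure on the carrier, because the same ring is *)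
(* considered below with several algebra structures.                          *)
Record calg (k : fieldType) := CAlg {
  asort :> comPzRingType;
  astr : {rmorphism k -> asort}
}.

Record ahom (k : fieldType) (A B : calg k) := AHom {
  afun :> {rmorphism A -> B};
  ahomE : forall c : k, afun (astr A c) = astr B c
}.

(* Functoriality is phrased up to pointwise equality of algebra morphisms.    *)
Record gfunctor (k : fieldType) := GFunctor {
  gpts :> calg k -> groupType;
  gmap : forall A B : calg k, ahom A B -> gpts A -> gpts B;
  gmapM : forall (A B : calg k) (f : ahom A B) (x y : gpts A),
    gmap f (x * y)%g = (gmap f x * gmap f y)%g;
  gmap_id : forall (A : calg k) (f : ahom A A),
    f =1 id -> gmap f =1 id;
  gmap_comp : forall (A B C : calg k) (f : ahom A B) (g : ahom B C)
      (h : ahom A C), h =1 g \o f -> gmap h =1 gmap g \o gmap f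
}.

Record ghom (k : fieldType) (F G : gfunctor k) := GHom {
  gfun :> forall A : calg k, F A -> G A;
  gfunM : forall (A : calg k) (x y : F A),
    gfun (x * y)%g = (gfun x * gfun y)%g;
  gfun_nat : forall (A B : calg k) (f : ahom A B) (x : F A),
    gfun (gmap f x) = gmap f (gfun x)
}.

Arguments gmap {k} g [A B] f x : rename.
Arguments gmapM {k} g [A B] f x y : rename.
Arguments gfun {k F G} _ A _.

Section Comp.
Variables (k : fieldType) (F : gfunctor k).

Fact acomp_subproof (A B C : calg k) (g : ahom B C) (f : ahom A B) (c : k) :
  (g \o f) (astr A c) = astr C c.
Proof. by rewrite /= !ahomE. Qed.
Definition acomp (A B C : calg k) (g : ahom B C) (f : ahom A B) : ahom A C :=
  @AHom k A C (g \o f : {rmorphism A -> C}) (acomp_subproof g f).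

Definition ahom1 (A : calg k) : ahom A A := @AHom k A A idfun (frefl _).

Lemma eq_gmap (A B : calg k) (f g : ahom A B) :
  f =1 g -> gmap F f =1 gmap F g.
Proof.
move=> fg x; rewrite -[RHS](@gmap_id _ F _ (ahom1 B)) //.
exact: (@gmap_comp _ F _ _ _ g (ahom1 B) f).
Qed.

Lemma gmap_square (A B B' C : calg k) (f : ahom A B) (g : ahom B C)
    (f' : ahom A B') (g' : ahom B' C) (x : F A) :
  g \o f =1 g' \o f' -> gmap F g (gmap F f x) = gmap F g' (gmap F f' x).
Proof.
move=> e; transitivity (gmap F (acomp g f) x).
  by symmetry; exact: (gmap_comp (h := acomp g f)).
exact: (gmap_comp (h := acomp g f)).
Qed.
End Comp.

Section GroupHom.
Variables (G H : groupType) (f : G -> H).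
Hypothesis fM : {morph f : x y / (x * y)%g}.
Lemma ghomf1 : f 1%g = 1%g.
Proof. by apply: (@mulgI _ (f 1%g)); rewrite -fM !mulg1. Qed.
Lemma ghomfV x : f x^-1%g = (f x)^-1%g.
Proof. by apply: (@mulgI _ (f x)); rewrite -fM !mulgV ghomf1. Qed.
End GroupHom.

Section Prod.
Variables (k : fieldType) (F G : gfunctor k).

Definition gprod_pts (A : calg k) : groupType := (F A * G A)%type.
Definition gprod_map A B (f : ahom A B) (x : gprod_pts A) : gprod_pts B :=
  (gmap F f x.1, gmap G f x.2).

Fact gprod_mapM A B (f : ahom A B) (x y : gprod_pts A) :
  gprod_map f (x * y)%g = (gprod_map f x * gprod_map f y)%g.
Proof. by congr pair; exact: gmapM. Qed.
Fact gprod_map_id A (f : ahom A A) : f =1 id -> gprod_map f =1 id.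
Proof. by move=> fE [x y]; congr pair; exact: gmap_id. Qed.
Fact gprod_map_comp A B C (f : ahom A B) (g : ahom B C) (h : ahom A C) :
  h =1 g \o f -> gprod_map h =1 gprod_map g \o gprod_map f.
Proof. by move=> hE [x y]; congr pair; exact: (gmap_comp hE). Qed.

Definition gprod := GFunctor gprod_mapM gprod_map_id gprod_map_comp.
End Prod.

Section Ker.
Variables (k : fieldType) (F G : gfunctor k) (u : ghom F G).

Definition gker_pred (A : calg k) : pred (F A) := fun x => u A x == 1%g.
Definition gker_pts (A : calg k) : Type := {x : F A | gker_pred x}.
HB.instance Definition _ A := Choice.on (gker_pts A).
HB.instance Definition _ A := [isSub of gker_pts A for sval].

Fact gker_closed A : group_closed (@gker_pred A).
Proof.
have uM := @gfunM _ _ _ u A.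
split=> [|x y]; rewrite /in_mem /= /gker_pred; first by rewrite (ghomf1 uM).
by move=> /eqP ux /eqP uy; rewrite uM (ghomfV uM) ux uy mulgV.
Qed.
HB.instance Definition _ A :=
  SubChoice_isSubGroup.Build (F A) (@gker_pred A) (gker_pts A) (gker_closed A).

Fact gker_map_subproof A B (f : ahom A B) (x : gker_pts A) :
  gker_pred (gmap F f (val x)).
Proof.
rewrite /gker_pred gfun_nat (eqP (valP x)).
by rewrite (ghomf1 (gmapM G f)).
Qed.
Definition gker_map A B (f : ahom A B) (x : gker_pts A) : gker_pts B :=
  Sub (gmap F f (val x)) (gker_map_subproof f x).

Fact gker_mapM A B (f : ahom A B) (x y : gker_pts A) :
  gker_map f (x * y)%g = (gker_map f x * gker_map f y)%g.
Proof. by apply: val_inj; rewrite /= gmapM. Qed.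
Fact gker_map_id A (f : ahom A A) : f =1 id -> gker_map f =1 id.
Proof. by move=> fE x; apply: val_inj; rewrite /= gmap_id. Qed.
Fact gker_map_comp A B C (f : ahom A B) (g : ahom B C) (h : ahom A C) :
  h =1 g \o f -> gker_map h =1 gker_map g \o gker_map f.
Proof. by move=> hE x; apply: val_inj; rewrite /= (gmap_comp hE). Qed.

Definition gker := GFunctor gker_mapM gker_map_id gker_map_comp.
End Ker.

Section Units.
Variable R : comPzRingType.

(* A unit together with its (unique) inverse: the R-points of                 *)
(* Spec k[u, v] / (u v - 1).                                                  *)
Definition units : Type := {p : R * R | p.1 * p.2 == 1}.
HB.instance Definition _ := Choice.on units.
HB.instance Definition _ := [isSub of units for sval].

Definition uval (x : units) : R := (val x).1.
Definition uinv (x : units) : R := (val x).2.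

Lemma uvalK (x : units) : uval x * uinv x = 1.
Proof. exact: (eqP (valP x)). Qed.

Definition Units (a b : R) (ab : a * b = 1) : units :=
  exist (fun p : R * R => p.1 * p.2 == 1) (a, b) (introT eqP ab).

Lemma uval_inj : injective uval.
Proof.
move=> x y xy; apply: val_inj; apply/eqP; rewrite -pair_eqE /=.
apply/andP; split; apply/eqP => //; change (uinv x = uinv y).
by rewrite -[LHS]mulr1 -(uvalK y) -xy mulrA [_ * uval x]mulrC uvalK mul1r.
Qed.

Fact units_mul_subproof (x y : units) :
  (uval x * uval y) * (uinv x * uinv y) = 1.
Proof. by rewrite mulrACA !uvalK mulr1. Qed.
Fact units_inv_subproof (x : units) : uinv x * uval x = 1.
Proof. by rewrite mulrC uvalK. Qed.

Definition units_one : units := Units (mulr1 1).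
Definition units_inv (x : units) : units := Units (units_inv_subproof x).
Definition units_mul (x y : units) : units := Units (units_mul_subproof x y).

Fact units_mulA : associative units_mul.
Proof. by move=> x y z; apply: uval_inj; rewrite /uval /= mulrA. Qed.
Fact units_mul1 : left_id units_one units_mul.
Proof. by move=> x; apply: uval_inj; rewrite /uval /= mul1r. Qed.
Fact units_1mul : right_id units_one units_mul.
Proof. by move=> x; apply: uval_inj; rewrite /uval /= mulr1. Qed.
Fact units_mulV : left_inverse units_one units_inv units_mul.
Proof. by move=> x; apply: uval_inj; exact: units_inv_subproof. Qed.
Fact units_Vmul : right_inverse units_one units_inv units_mul.
Proof. by move=> x; apply: uval_inj; exact: uvalK. Qed.

HB.instance Definition _ := isGroup.Build units
  units_mulA units_mul1 units_1mul units_mulV units_Vmul.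

Lemma unitsC (x y : units) : (x * y = y * x)%g.
Proof. by apply: uval_inj; exact: mulrC. Qed.

End Units.

Section UnitsMap.
Variables (R S : comPzRingType) (f : R -> S).
Hypotheses (f1 : f 1 = 1) (fM : {morph f : x y / x * y}).
Fact units_map_subproof (x : units R) : f (uval x) * f (uinv x) = 1.
Proof. by rewrite -fM uvalK. Qed.
Definition units_map (x : units R) : units S := Units (units_map_subproof x).
Fact units_mapM : {morph units_map : x y / (x * y)%g}.
Proof. by move=> x y; apply: uval_inj; exact: fM. Qed.
End UnitsMap.

Section Gm.
Variable k : fieldType.

Definition Gm_map (A B : calg k) (f : ahom A B) : units A -> units B :=
  units_map (rmorph1 f) (rmorphM f).
Fact Gm_mapM A B (f : ahom A B) (x y : units A) :
  Gm_map f (x * y)%g = (Gm_map f x * Gm_map f y)%g.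
Proof. exact: units_mapM. Qed.
Fact Gm_map_id A (f : ahom A A) : f =1 id -> Gm_map f =1 id.
Proof. by move=> fE x; apply: uval_inj; exact: fE. Qed.
Fact Gm_map_comp A B C (f : ahom A B) (g : ahom B C) (h : ahom A C) :
  h =1 g \o f -> Gm_map h =1 Gm_map g \o Gm_map f.
Proof. by move=> hE x; apply: uval_inj; exact: hE. Qed.

Definition Gm : gfunctor k :=
  @GFunctor k (fun A => units A) Gm_map Gm_mapM Gm_map_id Gm_map_comp.
End Gm.

Section Tensor.
Variables (k : fieldType) (L : fieldExtType k) (A : calg k).
Local Notation n := (\dim {:L}).
Local Notation e := (vbasis {:L}).

(* A (x)_k L, as the free A-module on the k-basis (e_i) = vbasis {:L} of L:   *)
(* the row (x_i) stands for \sum_i x_i (x) e_i.                               *)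
Definition tens : Type := 'rV[A]_n.
HB.instance Definition _ := GRing.Lmodule.on tens.

(* tin a = 1 (x) a *)
Definition tin (a : L) : tens := \row_i astr A (coord e i a).

Definition tmul (x y : tens) : tens :=
  \sum_i \sum_j (x 0 i * y 0 j) *: tin (e`_i * e`_j).

Lemma tinD a b : tin (a + b) = tin a + tin b.
Proof. by apply/rowP=> i; rewrite !mxE linearD rmorphD. Qed.
Lemma tinZ c a : tin (c *: a) = astr A c *: tin a.
Proof. by apply/rowP=> i; rewrite !mxE linearZ rmorphM. Qed.
Lemma tin0 : tin 0 = 0.
Proof. by apply/rowP=> i; rewrite !mxE linear0 rmorph0. Qed.
Lemma tinB a b : tin (a - b) = tin a - tin b.
Proof. by apply/rowP=> i; rewrite !mxE linearB rmorphB. Qed.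
Lemma tin_sum (I : Type) (r : seq I) (P : pred I) (F : I -> L) :
  tin (\sum_(i <- r | P i) F i) = \sum_(i <- r | P i) tin (F i).
Proof. exact: (big_morph tin tinD tin0). Qed.

Lemma basis_expand (a : L) : a = \sum_i coord e i a *: e`_i.
Proof. by apply: coord_vbasis; rewrite memvf. Qed.

Lemma tin_basis (i j : 'I_n) : tin e`_i 0 j = (i == j)%:R.
Proof.
rewrite mxE coord_free ?rmorph_nat //.
exact: basis_free (vbasisP _).
Qed.

Lemma tens_expand (x : tens) : x = \sum_i x 0 i *: tin e`_i.
Proof.
apply/rowP=> j; rewrite summxE (bigD1 j) //= mxE tin_basis eqxx mulr1.
by rewrite big1 ?addr0 // => i ij; rewrite mxE tin_basis (negPf ij) mulr0.
Qed.

Fact tmulDl : left_distributive tmul +%R.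
Proof.
move=> x y z; rewrite /tmul -big_split; apply: eq_bigr => i _.
rewrite -big_split; apply: eq_bigr => j _.
by rewrite mxE mulrDl scalerDl.
Qed.
Fact tmulC : commutative tmul.
Proof.
move=> x y; rewrite /tmul exchange_big; apply: eq_bigr => i _.
by apply: eq_bigr => j _; rewrite mulrC [X in tin X]mulrC.
Qed.
Fact tmulZl c (x y : tens) : tmul (c *: x) y = c *: tmul x y.
Proof.
rewrite /tmul scaler_sumr; apply: eq_bigr => i _.
rewrite scaler_sumr; apply: eq_bigr => j _.
by rewrite mxE scalerA mulrA.
Qed.
Fact tmulDr : right_distributive tmul +%R.
Proof. by move=> x y z; rewrite !(tmulC x) tmulDl. Qed.
Fact tmulZr c (x y : tens) : tmul x (c *: y) = c *: tmul x y.
Proof. by rewrite !(tmulC x) tmulZl. Qed.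
Fact tmul0l x : tmul 0 x = 0.
Proof. by rewrite -[X in tmul X](scale0r 0) tmulZl scale0r. Qed.
Fact tmul_suml (I : Type) (r : seq I) (P : pred I) (F : I -> tens) y :
  tmul (\sum_(i <- r | P i) F i) y = \sum_(i <- r | P i) tmul (F i) y.
Proof. exact: (big_morph (tmul^~ y) (fun a b => tmulDl a b y) (tmul0l y)). Qed.
Fact tmul_sumr (I : Type) (r : seq I) (P : pred I) (F : I -> tens) y :
  tmul y (\sum_(i <- r | P i) F i) = \sum_(i <- r | P i) tmul y (F i).
Proof. by rewrite tmulC tmul_suml; apply: eq_bigr => i _; rewrite tmulC. Qed.

Fact tinM a b : tin (a * b) = tmul (tin a) (tin b).
Proof.
rewrite {1}(basis_expand a) {1}(basis_expand b) mulr_suml tin_sum.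
apply: eq_bigr => i _; rewrite mulr_sumr tin_sum; apply: eq_bigr => j _.
by rewrite -scalerAl -scalerAr scalerA tinZ rmorphM !mxE.
Qed.

Fact tmulA : associative tmul.
Proof.
move=> x y z.
rewrite (tens_expand x) (tmul_suml _ _ _ (tmul y z)) (tmul_suml _ _ _ y).
rewrite (tmul_suml _ _ _ z); apply: eq_bigr => i _.
rewrite !tmulZl; congr (_ *: _).
rewrite (tens_expand y) (tmul_suml _ _ _ z) !(tmul_sumr _ _ _ (tin e`_i)).
rewrite (tmul_suml _ _ _ z); apply: eq_bigr => j _.
rewrite !(tmulZl, tmulZr); congr (_ *: _).
rewrite (tens_expand z) (tmul_sumr _ _ _ (tin e`_j)) tmul_sumr.
rewrite (tmul_sumr _ _ _ (tmul _ _)); apply: eq_bigr => l _.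
by rewrite !tmulZr -!tinM mulrA.
Qed.

Fact tmul1 : left_id (tin 1) tmul.
Proof.
move=> x; rewrite {1}(tens_expand x) tmul_sumr [RHS]tens_expand.
by apply: eq_bigr => i _; rewrite tmulZr -tinM mul1r.
Qed.

HB.instance Definition _ :=
  GRing.Zmodule_isComPzRing.Build tens tmulA tmulC tmul1 tmulDl.

Fact tin_is_zmod_morphism : zmod_morphism tin. Proof. exact: tinB. Qed.
Fact tin_is_monoid_morphism : monoid_morphism tin.
Proof. by split=> //; exact: tinM. Qed.
HB.instance Definition _ :=
  GRing.isZmodMorphism.Build L tens tin tin_is_zmod_morphism.
HB.instance Definition _ :=
  GRing.isMonoidMorphism.Build L tens tin tin_is_monoid_morphism.

Definition tens_alg : calg L := @CAlg L tens tin.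

(* r |-> r (x) 1 *)
Definition tscal (r : A) : tens := r *: tin 1.
Lemma tscal1 : tscal 1 = 1. Proof. exact: scale1r. Qed.
Lemma tscalM : {morph tscal : r s / r * s}.
Proof.
move=> r s; change (tscal (r * s) = tmul (tscal r) (tscal s)).
by rewrite /tscal tmulZl tmulZr tmul1 scalerA.
Qed.

End Tensor.

(* id (x) g : A (x) L -> A (x) L', for g : L -> L' a k-linear map             *)
Definition tmap (k : fieldType) (L L' : fieldExtType k) (A : calg k)
    (g : L -> L') (x : tens L A) : tens L' A :=
  \sum_i x 0 i *: tin A (g (vbasis {:L})`_i).

Section TensorMap.
Variables (k : fieldType) (A : calg k).

Lemma tmapD (L L' : fieldExtType k) (g : L -> L') :
  {morph @tmap k L L' A g : x y / x + y}.
Proof.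
move=> x y; rewrite /tmap -big_split; apply: eq_bigr => i _.
by rewrite mxE scalerDl.
Qed.
Lemma tmapZ (L L' : fieldExtType k) (g : L -> L') c (x : tens L A) :
  tmap g (c *: x) = c *: tmap g x.
Proof.
by rewrite /tmap scaler_sumr; apply: eq_bigr => i _; rewrite mxE scalerA.
Qed.
Lemma tmap0 (L L' : fieldExtType k) (g : L -> L') :
  tmap g (0 : tens L A) = 0.
Proof. by rewrite -[X in tmap g X](scale0r 0) tmapZ scale0r. Qed.
Lemma tmap_sum (L L' : fieldExtType k) (g : L -> L') (I : Type) (r : seq I)
  (P : pred I) (F : I -> tens L A) :
  tmap g (\sum_(i <- r | P i) F i) = \sum_(i <- r | P i) tmap g (F i).
Proof. exact: (big_morph (tmap g) (tmapD g) (tmap0 g)). Qed.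

Lemma tmap_tin (L L' : fieldExtType k) (g : {linear L -> L'}) a :
  tmap g (tin A a) = tin A (g a).
Proof.
rewrite [in RHS](basis_expand a) linear_sum tin_sum; apply: eq_bigr => i _.
by rewrite linearZ tinZ mxE.
Qed.

Lemma tmap_comp (L L' L'' : fieldExtType k) (g : {linear L' -> L''})
  (g' : L -> L') (x : tens L A) : tmap g (tmap g' x) = tmap (g \o g') x.
Proof.
by rewrite {2}/tmap tmap_sum; apply: eq_bigr => i _; rewrite tmapZ tmap_tin.
Qed.

Lemma eq_tmap (L L' : fieldExtType k) (g g' : L -> L') :
  g =1 g' -> tmap g =1 @tmap k L L' A g'.
Proof. by move=> gg' x; apply: eq_bigr => i _; rewrite gg'. Qed.

Lemma tmap_id (L : fieldExtType k) (x : tens L A) : tmap id x = x.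
Proof. by rewrite [RHS]tens_expand. Qed.

Lemma tmap1 (L L' : fieldExtType k) (g : {linear L -> L'}) :
  g 1 = 1 -> tmap g (1 : tens L A) = 1.
Proof. by move=> g1; rewrite tmap_tin g1. Qed.

Lemma tmapM (L L' : fieldExtType k) (g : {linear L -> L'}) :
  {morph g : a b / a * b} -> {morph @tmap k L L' A g : x y / x * y}.
Proof.
move=> gM x y; change (tmap g (tmul x y) = tmul (tmap g x) (tmap g y)).
rewrite {1}/tmul tmap_sum [X in _ = tmul X _]/tmap.
rewrite (tmul_suml _ _ _ (tmap g y)); apply: eq_bigr => i _.
rewrite tmap_sum tmulZl [X in _ *: tmul _ X]/tmap.
rewrite (tmul_sumr _ _ _ (tin A _)) scaler_sumr; apply: eq_bigr => j _.
by rewrite tmapZ tmap_tin gM tinM tmulZr scalerA.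
Qed.

Lemma tmap_tscal (L L' : fieldExtType k) (g : {linear L -> L'}) (r : A) :
  g 1 = 1 -> tmap g (tscal L r) = tscal L' r.
Proof. by move=> g1; rewrite /tscal tmapZ tmap_tin g1. Qed.

End TensorMap.

Section TensorBaseChange.
Variables (k : fieldType) (L : fieldExtType k).

(* f (x) id : A (x) L -> B (x) L                                              *)
Definition tbc (A B : calg k) (f : ahom A B) (x : tens L A) : tens L B :=
  map_mx f x.

Lemma tbc_tin A B (f : ahom A B) a : tbc f (tin A a) = tin B a.
Proof. by apply/rowP=> i; rewrite !mxE ahomE. Qed.
Lemma tbcD A B (f : ahom A B) : {morph tbc f : x y / x + y}.
Proof. by move=> x y; exact: map_mxD. Qed.
Lemma tbcZ A B (f : ahom A B) c x : tbc f (c *: x) = f c *: tbc f x.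
Proof. exact: map_mxZ. Qed.
Lemma tbc0 A B (f : ahom A B) : tbc f 0 = 0.
Proof. exact: map_mx0. Qed.
Lemma tbc_sum A B (f : ahom A B) (I : Type) (r : seq I) (P : pred I)
    (F : I -> tens L A) :
  tbc f (\sum_(i <- r | P i) F i) = \sum_(i <- r | P i) tbc f (F i).
Proof. exact: (big_morph (tbc f) (tbcD f) (tbc0 f)). Qed.

Fact tbc_is_zmod_morphism A B (f : ahom A B) : zmod_morphism (tbc f).
Proof. by move=> x y; exact: map_mxB. Qed.
Fact tbc_is_monoid_morphism A B (f : ahom A B) : monoid_morphism (tbc f).
Proof.
split=> [|x y]; first exact: tbc_tin.
rewrite [in LHS]/GRing.mul [in RHS]/GRing.mul /= /tmul tbc_sum.
apply: eq_bigr => i _; rewrite tbc_sum; apply: eq_bigr => j _.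
by rewrite tbcZ tbc_tin rmorphM !mxE.
Qed.
HB.instance Definition _ A B f := GRing.isZmodMorphism.Build
  (tens L A) (tens L B) (@tbc A B f) (tbc_is_zmod_morphism f).
HB.instance Definition _ A B f := GRing.isMonoidMorphism.Build
  (tens L A) (tens L B) (@tbc A B f) (tbc_is_monoid_morphism f).

Definition tbc_hom A B (f : ahom A B) : ahom (tens_alg L A) (tens_alg L B) :=
  @AHom L (tens_alg L A) (tens_alg L B) (@tbc A B f) (tbc_tin f).

End TensorBaseChange.

Lemma tbc_tmap (k : fieldType) (L L' : fieldExtType k) (A B : calg k)
  (f : ahom A B) (g : L -> L') (x : tens L A) :
  tbc f (tmap g x) = tmap g (tbc f x).
Proof.
rewrite tbc_sum; apply: eq_bigr => i _.
by rewrite tbcZ tbc_tin mxE.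
Qed.

Section Weil.
Variables (k : fieldType) (L : fieldExtType k) (F : gfunctor L).

Definition weil_pts (A : calg k) : groupType := F (tens_alg L A).
Definition weil_map A B (f : ahom A B) : weil_pts A -> weil_pts B :=
  gmap F (tbc_hom L f).
Fact weil_mapM A B (f : ahom A B) (x y : weil_pts A) :
  weil_map f (x * y)%g = (weil_map f x * weil_map f y)%g.
Proof. exact: gmapM. Qed.
Fact weil_map_id A (f : ahom A A) : f =1 id -> weil_map f =1 id.
Proof.
by move=> fE; apply: gmap_id => x; apply/rowP=> i; rewrite mxE; exact: fE.
Qed.
Fact weil_map_comp A B C (f : ahom A B) (g : ahom B C) (h : ahom A C) :
  h =1 g \o f -> weil_map h =1 weil_map g \o weil_map f.
Proof.
by move=> hE; apply: gmap_comp => x; apply/rowP=> i; rewrite !mxE; exact: hE.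
Qed.

Definition weil : gfunctor k := GFunctor weil_mapM weil_map_id weil_map_comp.
End Weil.

Section BaseChange.
Variables (k : fieldType) (L : fieldExtType k).

Definition restr (A : calg L) : calg k :=
  CAlg (astr A \o in_alg L : {rmorphism k -> A}).
Fact restr_hom_subproof (A B : calg L) (f : ahom A B) (c : k) :
  f (astr (restr A) c) = astr (restr B) c.
Proof. exact: ahomE. Qed.
Definition restr_hom (A B : calg L) (f : ahom A B) :
    ahom (restr A) (restr B) :=
  @AHom k (restr A) (restr B) f (restr_hom_subproof f).

Variable F : gfunctor k.

Definition bc_pts (A : calg L) : groupType := F (restr A).
Definition bc_map A B (f : ahom A B) : bc_pts A -> bc_pts B :=
  gmap F (restr_hom f).
Fact bc_mapM A B (f : ahom A B) (x y : bc_pts A) :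
  bc_map f (x * y)%g = (bc_map f x * bc_map f y)%g.
Proof. exact: gmapM. Qed.
Fact bc_map_id A (f : ahom A A) : f =1 id -> bc_map f =1 id.
Proof. by move=> fE; exact: gmap_id. Qed.
Fact bc_map_comp A B C (f : ahom A B) (g : ahom B C) (h : ahom A C) :
  h =1 g \o f -> bc_map h =1 bc_map g \o bc_map f.
Proof. by move=> hE; exact: gmap_comp. Qed.

Definition bc : gfunctor L := GFunctor bc_mapM bc_map_id bc_map_comp.
End BaseChange.

Section NormTorus.
Variables (k : fieldType) (K : splittingFieldType k) (E : {subfield K}).
Hypothesis galE : galois E {:K}.
Local Notation L := (subvs_of E).

(* N_{K/E}(y) = \prod_(h in Gal(K/E)) (id (x) h)(y), as in galNorm.  This     *)
(* product lies in the subring A (x) E of A (x) K (tnormE below), and is      *)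
(* transported there by the k-linear retraction vsproj E : K -> E.            *)
Definition tnorm (A : calg k) (y : tens K A) : tens L A :=
  tmap (vsproj E) (\prod_(h in 'Gal({:K} / E)) tmap h y).

Lemma tmap_gal1 (A : calg k) (h : gal_of {:K}) : tmap h (1 : tens K A) = 1.
Proof. by apply: tmap1; exact: rmorph1. Qed.
Lemma tmap_galM (A : calg k) (h : gal_of {:K}) :
  {morph @tmap k K K A h : x y / x * y}.
Proof. by apply: tmapM; exact: rmorphM. Qed.

Lemma tmap_vsval_inj (A : calg k) : injective (@tmap k L K A vsval).
Proof.
apply: (can_inj (g := tmap (vsproj E))) => x; rewrite tmap_comp.
by rewrite -[RHS]tmap_id; apply: eq_tmap => a; exact: vsvalK.
Qed.

Lemma galTrace_eq1 : exists b : K, galTrace E {:K} b = 1.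
Proof.
have [a _] := gal_independent_contra (P := mem 'Gal({:K} / E))
  (c_ := fun=> 1) (group1 _) (oner_neq0 K).
under eq_bigr do rewrite mul1r.
rewrite -/(galTrace E {:K} a) => tr_neq0.
exists (a / galTrace E {:K} a).
rewrite -[RHS](divff tr_neq0) [in LHS]/galTrace mulr_suml.
apply: eq_bigr => h hG; rewrite rmorphM fmorphV; congr (_ / _).
apply: fixed_gal hG _; first exact: subvf.
by apply: mem_galTrace; rewrite ?memvf.
Qed.

Lemma tens_descent (A : calg k) (z : tens K A) :
  (forall h, h \in 'Gal({:K} / E) -> tmap h z = z) ->
  tmap vsval (tmap (vsproj E) z) = z.
Proof.
move=> zfix; have [b trb] := galTrace_eq1.
suff [w ->] : exists w : tens L A, z = tmap vsval w.
  rewrite [tmap (vsproj E) _]tmap_comp; congr (tmap _ _).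
  by rewrite -[RHS]tmap_id; apply: eq_tmap => a; exact: vsvalK.
exists (tmap (fun x => vsproj E (galTrace E {:K} x)) (tin A b * z)).
rewrite tmap_comp -[LHS]mul1r -[1](erefl (tin A (1 : K))) -trb.
rewrite /galTrace tin_sum mulr_suml.
transitivity (\sum_(h in 'Gal({:K} / E)) tmap h (tin A b * z)).
  by apply: eq_bigr => h hG; rewrite tmap_galM tmap_tin zfix.
rewrite exchange_big; apply: eq_bigr => i _.
rewrite /= vsprojK; last by apply: mem_galTrace; rewrite ?memvf.
by rewrite /galTrace tin_sum scaler_sumr.
Qed.

Lemma tnormE (A : calg k) (y : tens K A) :
  tmap vsval (tnorm y) = \prod_(h in 'Gal({:K} / E)) tmap h y.
Proof.
apply: tens_descent => h hG.
rewrite (big_morph _ (tmap_galM h) (tmap_gal1 A h)).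
rewrite [RHS](reindex_inj (mulIg h)) /=.
apply: eq_big => [g|g _]; first by rewrite groupMr.
rewrite tmap_comp; apply: eq_tmap => a /=.
by rewrite galM ?memvf.
Qed.

Lemma tnorm1 (A : calg k) : tnorm (1 : tens K A) = 1.
Proof.
apply: tmap_vsval_inj; rewrite tnormE big1 => [|h _]; last exact: tmap_gal1.
by rewrite tmap1 //; exact: algid1.
Qed.

Lemma tnormM (A : calg k) : {morph @tnorm A : x y / x * y}.
Proof.
move=> x y; apply: tmap_vsval_inj; rewrite tnormE tmapM // !tnormE -big_split.
by apply: eq_bigr => h _; exact: tmap_galM.
Qed.

Lemma tbc_tnorm (A B : calg k) (f : ahom A B) (y : tens K A) :
  tbc f (tnorm y) = tnorm (tbc f y).
Proof.
rewrite tbc_tmap rmorph_prod; congr (tmap _ _).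
by apply: eq_bigr => h _; exact: tbc_tmap.
Qed.

Local Notation dom := (gprod (Gm k) (weil (Gm K))).
Local Notation cod := (weil (Gm L)).

(* (x, y) |-> x^-1 N_{K/E}(y), where x^-1 stands for its image x^-1 (x) 1 in  *)
(* R_{E/k}(Gm).                                                               *)
Definition norm_quot_fun (A : calg k) (z : dom A) : cod A :=
  ((units_map (@tscal1 k L A) (@tscalM k L A) z.1)^-1
   * units_map (@tnorm1 A) (@tnormM A) z.2)%g.

Fact norm_quot_funM (A : calg k) (x y : dom A) :
  norm_quot_fun (x * y)%g = (norm_quot_fun x * norm_quot_fun y)%g.
Proof.
rewrite /norm_quot_fun /= !units_mapM invgM.
rewrite [((units_map _ _ y.1)^-1 * _)%g]unitsC -!mulgA; congr (_ * _)%g.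
by rewrite !mulgA; congr (_ * _)%g; exact: unitsC.
Qed.

Fact norm_quot_fun_nat (A B : calg k) (f : ahom A B) (z : dom A) :
  norm_quot_fun (gmap dom f z) = gmap cod f (norm_quot_fun z).
Proof.
rewrite /norm_quot_fun gmapM.
rewrite (ghomfV (gmapM (weil (Gm L)) f)).
congr (_^-1 * _)%g; apply: uval_inj; rewrite /uval /=.
  by rewrite /tscal tbcZ tbc_tin.
by rewrite tbc_tnorm.
Qed.

Definition norm_quot : ghom dom cod := GHom norm_quot_funM norm_quot_fun_nat.

Definition torus : gfunctor k := gker norm_quot.

End NormTorus.
Arguments torus {k K} E galE.

(* The characters of a group functor over K form a type in a larger universe  *)
(* than the rings over which the functor is evaluated, whereas in MathComp    *)
(* the carriers of zmodType and comPzRingType share one universe: a character *)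
(* group cannot be a zmodType, hence this bare record.                        *)
Record abgroup := AbGroup {
  ab_sort :> Type;
  ab0 : ab_sort;
  abD : ab_sort -> ab_sort -> ab_sort;
  abN : ab_sort -> ab_sort;
  abDA : associative abD;
  abDC : commutative abD;
  ab0D : left_id ab0 abD;
  abND : left_inverse ab0 abN abD
}.
Arguments ab0 {a}.

Section AbTheory.
Variable M : abgroup.
Implicit Types x y z : M.

Lemma abD0 : right_id ab0 (@abD M).
Proof. by move=> x; rewrite abDC ab0D. Qed.
Lemma abDN x : abD x (abN x) = ab0.
Proof. by rewrite abDC abND. Qed.
Lemma abDI x : injective (abD x).
Proof.
by move=> y z e; rewrite -(ab0D y) -(ab0D z) -(abND x) -!abDA e.
Qed.
Lemma abDACA x y z t :
  abD (abD x y) (abD z t) = abD (abD x z) (abD y t).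
Proof.
by rewrite -!abDA; congr abD; rewrite !abDA; congr abD; exact: abDC.
Qed.
Lemma abNE x y : abD x y = ab0 -> y = abN x.
Proof. by move=> e; apply: (@abDI x); rewrite e abDN. Qed.
Lemma abNK x : abN (abN x) = x.
Proof. by symmetry; apply: abNE; rewrite abND. Qed.
Lemma abND2 x y : abN (abD x y) = abD (abN x) (abN y).
Proof. by symmetry; apply: abNE; rewrite abDACA !abDN ab0D. Qed.
Lemma abDB z x y :
  abD (abD z (abN x)) (abD x (abN y)) = abD z (abN y).
Proof. by rewrite -abDA (abDA (abN x)) abND ab0D. Qed.
Lemma abN0 : abN ab0 = ab0 :> M.
Proof. by symmetry; apply: abNE; rewrite ab0D. Qed.
End AbTheory.

Section AbQuotient.
Variables (M : abgroup) (P : M -> Prop).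
Hypotheses (P0 : P ab0) (PD : forall x y, P x -> P y -> P (abD x y)).
Hypothesis PN : forall x, P x -> P (abN x).

Definition abcoset (x : M) : M -> Prop := fun y => P (abD y (abN x)).
Definition abquot : Type := {S : M -> Prop | exists x, S = abcoset x}.
Definition abproj (x : M) : abquot :=
  exist _ (abcoset x) (ex_intro _ x (erefl (abcoset x))).

Lemma abquot_ext (S S' : abquot) : sval S = sval S' -> S = S'.
Proof.
case: S S' => S SP [S' S'P] /= SS'; case: _ / SS' in S'P *.
by congr exist; exact: Prop_irrelevance.
Qed.

Lemma abproj_surj (S : abquot) : exists x, S = abproj x.
Proof. by case: (svalP S) => x Sx; exists x; exact: abquot_ext. Qed.

Lemma abprojP x y : abproj x = abproj y <-> P (abD x (abN y)).
Proof.
split=> [[e]|Pxy].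
  by change (abcoset y x); rewrite -e /abcoset abDN.
apply: abquot_ext; apply/funext => z; apply/propext; split=> Pz.
  by have := PD Pz Pxy; rewrite abDB.
by have := PD Pz (PN Pxy); rewrite abND2 abNK (abDC _ y) abDB.
Qed.

Definition abrepr (S : abquot) : M := sval (cid (abproj_surj S)).
Lemma abreprK S : abproj (abrepr S) = S.
Proof. by rewrite /abrepr; case: cid. Qed.

Definition abquotD (S S' : abquot) : abquot :=
  abproj (abD (abrepr S) (abrepr S')).
Definition abquotN (S : abquot) : abquot := abproj (abN (abrepr S)).

Lemma abprojD x y : abproj (abD x y) = abquotD (abproj x) (abproj y).
Proof.
apply/abprojP; rewrite abND2 abDACA.
by apply: PD; apply/abprojP; rewrite abreprK.
Qed.
Lemma abprojN x : abproj (abN x) = abquotN (abproj x).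
Proof. by apply/abprojP; rewrite -abND2; apply/PN/abprojP; rewrite abreprK. Qed.

Fact abquotDA : associative abquotD.
Proof.
move=> S S' S''; rewrite -(abreprK S) -(abreprK S') -(abreprK S'').
by rewrite -!abprojD abDA.
Qed.
Fact abquotDC : commutative abquotD.
Proof.
by move=> S S'; rewrite -(abreprK S) -(abreprK S') -!abprojD abDC.
Qed.
Fact abquot0D : left_id (abproj ab0) abquotD.
Proof. by move=> S; rewrite -(abreprK S) -abprojD ab0D. Qed.
Fact abquotND : left_inverse (abproj ab0) abquotN abquotD.
Proof. by move=> S; rewrite -(abreprK S) -abprojN -abprojD abND. Qed.

Definition ab_quotient : abgroup := AbGroup abquotDA abquotDC abquot0D abquotND.
End AbQuotient.

Lemma gal_setT (k : fieldType) (K : splittingFieldType k) :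
  'Gal({:K} / 1) = [set: gal_of {:K}].
Proof.
apply/eqP; rewrite eqEsubset subsetT /=.
apply: subset_trans (galois_connection_subset _) (galS _ _).
exact: sub1v.
Qed.

(* Right modules: in MathComp Galois automorphisms compose from left to       *)
(* right, (x * y)%g a = y (x a), so the Galois group acts on the right.       *)
Record gmodule (gT : finGroupType) := GModule {
  gmod_ab :> abgroup;
  gact : gmod_ab -> gT -> gmod_ab;
  gactD : forall m n x, gact (abD m n) x = abD (gact m x) (gact n x);
  gact1 : forall m, gact m 1%g = m;
  gactM : forall m x y, gact m (x * y)%g = gact (gact m x) y
}.

Section H1.
Variables (gT : finGroupType) (M : gmodule gT).

Lemma gact0 x : gact (ab0 : M) x = ab0.
Proof. by apply: (@abDI _ (gact ab0 x)); rewrite -gactD !abD0. Qed.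
Lemma gactN (m : M) x : gact (abN m) x = abN (gact m x).
Proof. by apply: abNE; rewrite -gactD abDN gact0. Qed.

Definition cocycle (f : gT -> M) : Prop :=
  forall x y, f (x * y)%g = abD (gact (f x) y) (f y).
Definition coboundary (f : gT -> M) : Prop :=
  exists m, forall x, f x = abD (gact m x) (abN m).

Definition cocycles : Type := {f : gT -> M | cocycle f}.

Lemma cocycles_ext (f g : cocycles) : sval f =1 sval g -> f = g.
Proof.
case: f g => f fP [g gP] /= /funext fg; case: _ / fg in gP *.
by congr exist; exact: Prop_irrelevance.
Qed.

Fact cocycle0 : cocycle (fun=> ab0).
Proof. by move=> x y; rewrite gact0 ab0D. Qed.
Fact cocycleD (f g : cocycles) : cocycle (fun x => abD (sval f x) (sval g x)).
Proof. by move=> x y; rewrite (svalP f) (svalP g) gactD abDACA. Qed.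
Fact cocycleN (f : cocycles) : cocycle (fun x => abN (sval f x)).
Proof. by move=> x y; rewrite (svalP f) gactN abND2. Qed.

Definition cocycles0 : cocycles := exist _ _ cocycle0.
Definition cocyclesD f g : cocycles := exist _ _ (cocycleD f g).
Definition cocyclesN f : cocycles := exist _ _ (cocycleN f).

Fact cocyclesDA : associative cocyclesD.
Proof. by move=> f g h; apply: cocycles_ext => x /=; rewrite abDA. Qed.
Fact cocyclesDC : commutative cocyclesD.
Proof. by move=> f g; apply: cocycles_ext => x; exact: abDC. Qed.
Fact cocycles0D : left_id cocycles0 cocyclesD.
Proof. by move=> f; apply: cocycles_ext => x; exact: ab0D. Qed.
Fact cocyclesND : left_inverse cocycles0 cocyclesN cocyclesD.
Proof. by move=> f; apply: cocycles_ext => x; exact: abND. Qed.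

Definition Z1 : abgroup := AbGroup cocyclesDA cocyclesDC cocycles0D cocyclesND.

Definition B1 (f : Z1) : Prop := coboundary (sval f).

Fact B1_0 : B1 ab0.
Proof. by exists ab0 => x; rewrite gact0 abDN. Qed.
Fact B1_D f g : B1 f -> B1 g -> B1 (abD f g).
Proof.
move=> [m fE] [n gE]; exists (abD m n) => x.
by rewrite /= fE gE gactD abND2 abDACA.
Qed.
Fact B1_N f : B1 f -> B1 (abN f).
Proof. by move=> [m fE]; exists (abN m) => x; rewrite /= fE gactN abND2. Qed.

(* Tate cohomology is ordinary group cohomology in degree 1.                  *)
Definition H1 : abgroup := ab_quotient B1_0 B1_D B1_N.

End H1.

Section Characters.
Variables (k : fieldType) (K : splittingFieldType k) (T : gfunctor k).

(* Homomorphisms T_K -> Gm_K of group functors over K.                        *)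
Definition chars : Type := ghom (bc K T) (Gm K).

Lemma chars_ext (a b : chars) :
  (forall (A : calg K) (x : bc K T A), a A x = b A x) -> a = b.
Proof.
case: a b => [f fM fN] [g gM gN] /= fg.
have {}fg : f = g 
  by apply: functional_extensionality_dep => A; apply/funext => x; exact: fg.
by case: _ / fg in gM gN *; congr GHom; exact: Prop_irrelevance.
Qed.

Fact char0M (A : calg K) (x y : bc K T A) : (1 : Gm K A)%g = (1 * 1)%g.
Proof. by rewrite mulg1. Qed.
Fact char0N (A B : calg K) (f : ahom A B) (x : bc K T A) :
  1%g = gmap (Gm K) f (1 : Gm K A)%g.
Proof. by rewrite (ghomf1 (gmapM _ f)). Qed.
Definition char0 : chars := @GHom K (bc K T) (Gm K) (fun A _ => 1%g) char0M char0N.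

Fact charNM (a : chars) (A : calg K) (x y : bc K T A) :
  (a A (x * y) )^-1%g = ((a A x)^-1 * (a A y)^-1)%g.
Proof. by rewrite gfunM invgM; exact: unitsC. Qed.
Fact charNN (a : chars) (A B : calg K) (f : ahom A B) (x : bc K T A) :
  (a B (gmap (bc K T) f x))^-1%g = gmap (Gm K) f ((a A x)^-1)%g.
Proof. by rewrite (ghomfV (gmapM _ f)) gfun_nat. Qed.
Definition charN (a : chars) : chars :=
  @GHom K (bc K T) (Gm K) (fun A x => (a A x)^-1%g) (charNM a) (charNN a).

Fact charDM (a b : chars) (A : calg K) (x y : bc K T A) :
  (a A (x * y) * b A (x * y))%g = (a A x * b A x * (a A y * b A y))%g.
Proof.
rewrite !gfunM -!mulgA; congr (_ * _)%g; rewrite !mulgA; congr (_ * _)%g.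
exact: unitsC.
Qed.
Fact charDN (a b : chars) (A B : calg K) (f : ahom A B) (x : bc K T A) :
  (a B (gmap (bc K T) f x) * b B (gmap (bc K T) f x))%g = gmap (Gm K) f (a A x * b A x)%g.
Proof. by rewrite gmapM !gfun_nat. Qed.
Definition charD (a b : chars) : chars :=
  @GHom K (bc K T) (Gm K) (fun A x => (a A x * b A x)%g)
    (charDM a b) (charDN a b).

Fact charDA : associative charD.
Proof. by move=> a b c; apply: chars_ext => A x /=; rewrite mulgA. Qed.
Fact charDC : commutative charD.
Proof. by move=> a b; apply: chars_ext => A x; exact: unitsC. Qed.
Fact char0D : left_id char0 charD.
Proof. by move=> a; apply: chars_ext => A x; exact: mul1g. Qed.
Fact charND : left_inverse char0 charN charD.
Proof. by move=> a; apply: chars_ext => A x; exact: mulVg. Qed.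
Definition char_group : abgroup := AbGroup charDA charDC char0D charND.

(* The K-algebra A, with K acting through s : K -> K. It has the same         *)
(* underlying k-algebra as A.                                                 *)
Definition twist (s : gal_of {:K}) (A : calg K) : calg K :=
  CAlg (astr A \o s : {rmorphism K -> A}).

Fact twist_hom_subproof s (A B : calg K) (f : ahom A B) (c : K) :
  f (astr (twist s A) c) = astr (twist s B) c.
Proof. exact: ahomE. Qed.
Definition twist_hom s (A B : calg K) (f : ahom A B) :
    ahom (twist s A) (twist s B) :=
  @AHom K (twist s A) (twist s B) f (twist_hom_subproof s f).

Fact twist_id_subproof s (A : calg K) (c : k) :
  idfun (astr (restr A) c) = astr (restr (twist s A)) c.
Proof. by rewrite /= linearZ /= rmorph1. Qed.
Definition twist_id s (A : calg K) : ahom (restr A) (restr (twist s A)) :=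
  @AHom k (restr A) (restr (twist s A)) idfun (twist_id_subproof s A).

(* (s chi)_A is chi on the twist of A: if chi is given by \sum_i f_i (x) c_i  *)
(* in k[T] (x) K, this is the character given by \sum_i f_i (x) s(c_i).       *)
Definition char_act_fun (a : chars) (s : gal_of {:K}) (A : calg K)
    (x : bc K T A) : Gm K A :=
  a (twist s A) (gmap T (twist_id s A) x).

Fact char_actM a s (A : calg K) (x y : bc K T A) :
  char_act_fun a s (x * y)%g = (char_act_fun a s x * char_act_fun a s y)%g.
Proof. by rewrite /char_act_fun [gmap _ _ _](gmapM T) gfunM. Qed.
Fact char_actN a s (A B : calg K) (f : ahom A B) (x : bc K T A) :
  char_act_fun a s (gmap (bc K T) f x) = gmap (Gm K) f (char_act_fun a s x).
Proof.
transitivity (gmap (Gm K) (twist_hom s f) (char_act_fun a s x)); last first.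
  exact: uval_inj.
rewrite /char_act_fun -gfun_nat; apply: (congr1 (gfun a (twist s B))).
exact: (gmap_square (F := T) (f := restr_hom f) (g := twist_id s B)
  (f' := twist_id s A) (g' := restr_hom (twist_hom s f))).
Qed.
Definition char_act (a : chars) (s : gal_of {:K}) : chars :=
  GHom (char_actM a s) (char_actN a s).


Fact char_actD a b s :
  char_act (charD a b) s = charD (char_act a s) (char_act b s).
Proof. exact: chars_ext. Qed.

Fact twist1_subproof (A : calg K) (c : K) :
  idfun (astr A c) = astr (twist 1%g A) c.
Proof. by rewrite /= gal_id. Qed.
Fact char_act1 a : char_act a 1%g = a.
Proof.
apply: chars_ext => A x.
pose f : ahom A (twist 1%g A) :=
  @AHom K A (twist 1%g A) idfun (twist1_subproof A).
transitivity (gmap (Gm K) f (a A x)); last exact: uval_inj.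
rewrite -gfun_nat; apply: (congr1 (gfun a (twist 1%g A))).
exact: (eq_gmap (F := T) (f := twist_id 1%g A) (g := restr_hom f)).
Qed.

Fact twistM_subproof s t (A : calg K) (c : K) :
  idfun (astr (twist s (twist t A)) c) = astr (twist (s * t)%g A) c.
Proof. by rewrite /= galM ?memvf. Qed.
Fact char_actMr a s t : char_act a (s * t)%g = char_act (char_act a s) t.
Proof.
apply: chars_ext => A x.
pose f : ahom (twist s (twist t A)) (twist (s * t)%g A) :=
  @AHom K (twist s (twist t A)) (twist (s * t)%g A) idfun
    (twistM_subproof s t A).
transitivity (gmap (Gm K) f (char_act (char_act a s) t A x)).
  rewrite /= /char_act_fun /= /char_act_fun.
  rewrite -[RHS](gfun_nat a f); apply: (congr1 (gfun a (twist (s * t)%g A))).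
  pose g := acomp (twist_id s (twist t A)) (twist_id t A).
  transitivity (gmap T (acomp (restr_hom f) g) x).
    exact: (eq_gmap (F := T) (f := twist_id (s * t)%g A)
      (g := acomp (restr_hom f) g)).
  transitivity (gmap T (restr_hom f) (gmap T g x)); last first.
    congr (gmap (bc K T) f _); exact: (@gmap_comp _ T _ _ _ (twist_id t A) (twist_id s (twist t A)) g).
  exact: (@gmap_comp _ T _ _ _ g (restr_hom f) (acomp (restr_hom f) g)).
exact: uval_inj.
Qed.

(* gal_of {:K} is all of Gal(K/k), by gal_setT.                               *)
Definition char_module : gmodule (gal_of {:K}) :=
  GModule (gmod_ab := char_group) char_actD char_act1 char_actMr.

End Characters.
Arguments char_module {k} K T.

(* Main.v *)
(* Write X for the character lattice, G for the Galois group and H = <h> for  *)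
(* the central subgroup of order p. Over K the tensor product splits as       *)
(* A (x)_k K = A^G, and T becomes {y in Gm^G : the products of y over the     *)
(* cosets of H are all equal}. Hence X is Z[G] modulo the H-invariant         *)
(* elements of degree 0.                                                      *)
(*   A cocycle f : G -> X has degree 0, and as h is central the degree mod p  *)
(* of f(h) on a coset of H does not depend on the coset. This gives           *)
(* theta : H^1(G, X) -> Z/p. It is injective: if theta(f) = 0 then            *)
(* f(h) = w h - w for some w, and subtracting the coboundary of w leaves a    *)
(* cocycle with H-invariant values of degree 0, that is, 0.                   *)
(*   If a Sylow p-subgroup P is cyclic, then theta(f) is the sum of f(g) over *)
(* each coset of P for a generator g of P, so (G : P) theta(f) = 0. Otherwise *)
(* x^(G : H) = 1 for all x, i.e., the transfer from G to H is trivial; then,  *)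
(* writing each g as h^kappa(g) r(g) with r(g) a coset representative and m   *)
(* for the element of X with coefficients kappa, m x - m is divisible by p,   *)
(* and f(x) = (m x - m) / p is a cocycle with theta(f) = 1.                   *)
Require Import Defs.
From HB Require Import structures.
From mathcomp Require Import all_boot all_order all_algebra.
From mathcomp Require Import all_fingroup all_solvable all_field.
From mathcomp Require Import boolp ring.

Set Implicit Arguments.
Unset Strict Implicit.
Unset Printing Implicit Defensive.

Import Defs GRing.Theory GroupScope.
Local Open Scope ring_scope.

(** * The cohomology of the lattice *)

(** The cohomology is computed for any module M presented by a map [Phi] as Z[G] modulo the
    H-invariant elements of degree 0. The degree [csum] on a coset of H is well defined mod p on M
    ([dvdz_csum]) and for f(h) is the same on all cosets ([csum_const]); this is theta. Its
    injectivity is [coboundary_of_csum], its vanishing in the cyclic case is [csum_cyclic], and a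
    class of value 1 in the other case is built in [cocycle_of_transfer] from [central_transfer];
    [cyclic_Sylow_of_expg] separates the two cases. For the torus, [Phi] is [torus_char].
    Independence of automorphisms splits the tensor product ([tev_inj], [tev_surj]), so points are
    families indexed by G. A character restricted to a cocharacter is a power map ([Gm_end]), and
    points are products of values of cocharacters: hence [torus_char_surj]. Pairing with
    cocharacters also gives the kernel ([torus_char_eq0]). *)

Lemma sum_rcosets (gT : finGroupType) (H : {group gT}) (V : nmodType)
    (F : gT -> V) :
  \sum_g F g = \sum_(c in rcosets H [set: gT]) \sum_(h in H) F (h * repr c)%g.
Proof.
rewrite (partition_big (fun g => H :* g)%g (mem (rcosets H [set: gT]))) /=;
  last first.
  by move=> g _; apply/imsetP; exists g; rewrite ?inE // rcosetE.
apply: eq_bigr => _ /rcosetsP[u _ ->]; 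
rewrite (reindex_inj (mulIg (repr (H :* u)))).
have := rcoset_repr H u; move: (repr _) => y yE.
apply: eq_bigl => h; rewrite rcosetM; apply/eqP/idP => [e|hH]; last first.
  by rewrite (rcoset_id hH).
have : (h * y \in H :* y)%g by rewrite yE -e -rcosetM rcoset_refl.
by rewrite mem_rcoset mulgK.
Qed.

Lemma mulrnz (a : int) n : a *+ n = a * n%:Z.
Proof. by rewrite -mulr_natr natz. Qed.

(** * The transfer to a central cyclic subgroup *)

Section Transfer.
Variables (gT : finGroupType) (h : gT).
Hypothesis hC : forall g, commute h g.
Local Notation rcos g := (repr (<[h]> :* g))%g.

Lemma rcos_decomp (g : gT) : exists2 i : nat,
  (i < #[h]%g)%N & g = (h ^+ i * rcos g)%g.
Proof.
case: repr_rcosetP => x; rewrite -groupV => /cyclePmin[i lti].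
by move=> e; exists i => //; rewrite mulgA -e mulVg mul1g.
Qed.

(** The sum is the exponent of h in the transfer of x to <h>. The expansion along the orbits of x on
    the cosets writes this transfer as a product of conjugates of powers of x lying in <h>; by
    centrality the conjugations disappear, and the orbit lengths add up to the index, so the
    transfer is x^(G : <h>) = 1. *)
Lemma central_transfer (kappa : gT -> nat) :
    (forall g, g = (h ^+ kappa g * rcos g)%g) ->
    (forall x : gT, x ^+ #|[set: gT] : <[h]>| = 1)%g ->
  forall x,
  (#[h]%g %| \sum_(c in rcosets <[h]> [set: gT]) kappa (repr c * x)%g)%N.
Proof.
move=> kappaP xm1 x.
have abA : abelian (idm <[h]> @* <[h]>) by rewrite morphim_idm // cycle_abelian.
have sHG := subsetT <[h]>%g.
have Gx := in_setT x.
have trX := transversalP (rcosets_cycle_partition sHG Gx).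
have := transfer_cycle_expansion sHG abA Gx trX.
have abX i : FiniteModule.fmod abA (h ^+ i)%g = FiniteModule.fmod abA h *+ i.
  by rewrite FiniteModule.fmodX // (mem_morphim (idm <[h]>)) ?cycle_id.
(* Left side: the definition of the transfer, with the canonical coset representatives. *)
rewrite (_ : transfer _ _ _ = FiniteModule.fmod abA (h ^+
  (\sum_(c in rcosets <[h]> [set: gT]) kappa (repr c * x)%g)%N)%g); last first.
  rewrite abX -sumrMnr; apply: eq_bigr => c /rcosetsP[y _ ->].
  rewrite -abX; congr (FiniteModule.fmod _ _) => /=.
  rewrite /idm /= {1}[(repr _ * x)%g]kappaP rcosetM rcoset_repr -rcosetM.
  by rewrite mulgK.
(* Right side: the orbit expansion, trivial by the assumption on exponents. *)
rewrite [X in _ = X](_ : _ = 0); last first.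
  have key y : y \in transversal (rcosets <[h]> [set: gT] :* <[x]>) [set: gT] ->
      (x ^+ #|<[x]> : <[h]> :* y|)%g \in <[h]>%g /\
      ((x ^+ #|<[x]> : <[h]> :* y|) ^ y^-1 = x ^+ #|<[x]> : <[h]> :* y|)%g.
    move=> _; set u := (x ^+ _)%g.
    have : (u ^ y^-1 \in <[h]>)%g.
      by rewrite conjgE invgK mulgA -mem_rcoset; exact: mulg_exp_card_rcosets.
    case/cycleP=> i ui; suff e : (u = h ^+ i)%g by rewrite ui e mem_cycle.
    by rewrite -(conjgKV y u) ui conjgE -(commuteX i (commute_sym (hC y)))
      mulKg.
  set X := transversal _ _ in key *.
  transitivity (\sum_(y in X)
      FiniteModule.fmod abA (x ^+ #|<[x]> : <[h]> :* y|)%g).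
    by apply: eq_bigr => y /key[_ e]; rewrite -[in RHS]e.
  have [] : \sum_(y in X) FiniteModule.fmod abA (x ^+ #|<[x]> : <[h]> :* y|)%g =
    FiniteModule.fmod abA (x ^+ (\sum_(y in X) #|<[x]> : <[h]> :* y|)%N)%g /\
    (x ^+ (\sum_(y in X) #|<[x]> : <[h]> :* y|)%N \in <[h]>)%g.
    elim/big_rec2: _ => [|y a b /key[yH _] [-> bH]].
      by rewrite FiniteModule.fmod1 group1.
    rewrite expgD groupM //; split=> //.
    by rewrite FiniteModule.fmodM ?(mem_morphim (idm <[h]>)).
  move=> -> _; rewrite (sum_index_rcosets_cycle sHG Gx trX) xm1.
  exact: FiniteModule.fmod1.
move/(congr1 FiniteModule.fmval); rewrite FiniteModule.fmval0.
rewrite [FiniteModule.fmval _]FiniteModule.fmodK; last first.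
  by rewrite (mem_morphim (idm <[h]>)) ?mem_cycle.
by move/eqP; rewrite -order_dvdn.
Qed.
End Transfer.

(** * The group H^1 of a quotient of Z[G] *)

Section Presentation.
Variables (gT : finGroupType) (M : gmodule gT) (p : nat) (h : gT).
Hypotheses (p_pr : prime p) (oh : #[h]%g = p) (hC : forall g, commute h g).
Variable Phi : {ffun gT -> int} -> M.
Hypothesis PhiB : forall a b, Phi (a - b) = abD (Phi a) (abN (Phi b)).

(** Right multiplication by s on Z[G]: the basis element g goes to g s. *)
Definition shift (s : gT) (a : {ffun gT -> int}) : {ffun gT -> int} :=
  [ffun g => a (g * s^-1)%g].
Hypothesis Phi_act : forall a s, gact (Phi a) s = Phi (shift s a).
Hypothesis Phi_surj : forall m, exists a, Phi a = m.
Hypothesis Phi_ker : forall a : {ffun gT -> int},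
  Phi a = ab0 <-> (forall g, a (h * g)%g = a g) /\ \sum_g a g = 0.

Definition Phi_lift (m : M) : {ffun gT -> int} := sval (cid (Phi_surj m)).
Lemma Phi_liftK m : Phi (Phi_lift m) = m.
Proof. by rewrite /Phi_lift; case: cid. Qed.

Lemma Phi0 : Phi 0 = ab0.
Proof. by rewrite -[0](subrr 0) PhiB abDN. Qed.
Lemma PhiN a : Phi (- a) = abN (Phi a).
Proof. by rewrite -sub0r PhiB Phi0 ab0D. Qed.
Lemma PhiD a b : Phi (a + b) = abD (Phi a) (Phi b).
Proof. by rewrite -[b in LHS]opprK PhiB PhiN abNK. Qed.
Lemma Phi_eq a b : Phi a = Phi b -> Phi (a - b) = ab0.
Proof. by move=> e; rewrite PhiB e abDN. Qed.

Definition csum (a : {ffun gT -> int}) (g : gT) : int :=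
  \sum_(i < p) a (h ^+ i * g)%g.

Lemma csumB a b g : csum (a - b) g = csum a g - csum b g.
Proof. by rewrite /csum -sumrB; apply: eq_bigr => i _; rewrite !ffunE. Qed.

Lemma csumD a b g : csum (a + b) g = csum a g + csum b g.
Proof. by rewrite /csum -big_split /=; apply: eq_bigr => i _;
  rewrite !ffunE. Qed.

Lemma csumN a g : csum (- a) g = - csum a g.
Proof. by rewrite -sub0r csumB {1}/csum big1 ?sub0r // => i _;
  rewrite ffunE. Qed.

Lemma csum_shift s a g : csum (shift s a) g = csum a (g * s^-1)%g.
Proof. by rewrite /csum; apply: eq_bigr => i _; rewrite ffunE mulgA. Qed.

Lemma csum_h a g : csum a (h * g)%g = csum a g.
Proof.
rewrite /csum -(prednK (prime_gt0 p_pr)) big_ord_recr [RHS]big_ord_recl /=.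
rewrite [RHS]addrC; congr (_ + a _).
  by apply: eq_bigr => i _; rewrite mulgA -expgSr.
by rewrite mulgA -expgSr prednK ?prime_gt0 // -oh expg_order expg0.
Qed.

Lemma inv_expg (a : {ffun gT -> int}) :
  (forall g, a (h * g)%g = a g) -> forall i g, a (h ^+ i * g)%g = a g.
Proof.
by move=> ah i g; elim: i => [|i IH]; rewrite ?mul1g // expgS -mulgA ah.
Qed.

Lemma csum_inv (a : {ffun gT -> int}) g :
  (forall g, a (h * g)%g = a g) -> csum a g = a g *+ p.
Proof.
move=> /inv_expg ah; rewrite -[in RHS](card_ord p) -sumr_const.
by apply: eq_bigr => i _.
Qed.

Lemma sum_csum a : \sum_g csum a g = (\sum_g a g) *+ p.
Proof.
rewrite exchange_big -[in RHS](card_ord p) -sumr_const; apply: eq_bigr => i _.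
by rewrite [RHS](reindex_inj (mulgI (h ^+ i)%g)).
Qed.

Lemma sum_shift s a : \sum_g shift s a g = \sum_g a g.
Proof.
rewrite [RHS](reindex_inj (mulIg s^-1%g)).
by apply: eq_bigr => g _; rewrite ffunE.
Qed.

(** An element of the kernel is constant on each coset of H, so its coset sums are multiples of
    p. *)
Lemma dvdz_csum a b g : Phi a = Phi b -> (p %| csum a g - csum b g)%Z.
Proof.
move=> /Phi_eq/Phi_ker[inv _].
by rewrite -csumB csum_inv // mulrnz dvdz_mull.
Qed.

Lemma sum_Phi a b : Phi a = Phi b -> \sum_g a g = \sum_g b g.
Proof.
move=> /Phi_eq/Phi_ker[_ s0]; apply/eqP; rewrite -subr_eq0 -sumrB -[X in _ ==
  X]s0.
by apply/eqP; apply: eq_bigr => g _; rewrite !ffunE.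
Qed.

(** Z[G] is free over Z[H] and H is cyclic, so the kernel of the norm of H is the image of h - 1. A
    preimage is given by partial sums of a along each coset. *)
Lemma csum_eq0_boundary (a : {ffun gT -> int}) :
  (forall g, csum a g = 0) -> exists b, a = shift h b - b.
Proof.
move=> a0.
have [r rP] : exists r : gT -> gT, forall g,
    (exists2 i : nat, (i < p)%N & g = (h ^+ i * r g)%g) /\ r (h * g)%g = r g.
  exists (fun g => repr (<[h]> :* g)%g) => g; split; last first.
    by rewrite rcosetM (rcoset_id (cycle_id h)).
  case: repr_rcosetP => x; rewrite -groupV => /cyclePmin[i]; rewrite oh => lti.
  by move=> e; exists i => //; rewrite mulgA -e mulVg mul1g.
have /choice[k kP] : forall g, exists i : nat, g = (h ^+ i * r g)%g.
  by move=> g; have [[i _ e] _] := rP g; exists i.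
pose W n g : int := \sum_(i < n) a (h ^+ i * g)%g.
have WS n g : W n.+1 g = W n g + a (h ^+ n * g)%g by rewrite /W big_ord_recr.
(* As the coset sums vanish, the partial sums have period p; the exponent [k g], meaningful only mod
   p, can therefore be used as their length. *)
have WDp n g : W (n + p)%N g = W n g.
  rewrite /W big_split_ord /= [X in _ + X](_ : _ = csum a (h ^+ n * g)%g).
    by rewrite a0 addr0.
  by apply: eq_bigr => i _; rewrite mulgA -expgD addnC.
have Wmod n g : W (n %% p)%N g = W n g.
  rewrite [in RHS](divn_eq n p) addnC; elim: (n %/ p)%N => [|m ->].
    by rewrite addn0.
  by rewrite mulSnr addnA WDp.
(* The value of [shift h b - b] at g is the difference of two consecutive partial sums, whose last
   term is a(g). *)
pose b := [ffun g => - W (k g).+1 (r g)].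
exists b; apply/ffunP => g; rewrite !ffunE.
set g' := (g * h^-1)%g; have eg : g = (h * g')%g by rewrite hC mulgKV.
have rg : r g = r g' by rewrite eg; case: (rP g').
have ek : k g = (k g').+1 %[mod p].
  apply/eqP; rewrite -oh -eq_expg_mod_order; apply/eqP.
  by apply: (mulIg (r g)); rewrite -kP expgS -mulgA rg -kP.
have ekS : (k g).+1 = (k g').+2 %[mod p].
  by rewrite -addn1 -modnDml ek modnDml addn1.
rewrite opprK -[W (k g).+1 _]Wmod ekS Wmod.
by rewrite -rg [W (k g').+2 _]WS addKr expgS -mulgA rg -kP eg.
Qed.

Section Cocycle.
Variable f : gT -> M.
Hypothesis fP : cocycle f.

Lemma cocycle_at1 : f 1%g = ab0.
Proof. by apply: (@abDI _ (f 1%g)); rewrite abD0 -{1}(gact1 (f 1%g)) -fP mulg1.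
  Qed.

(** The degree is a G-invariant homomorphism from M to Z, so its composite with f is a homomorphism
    from a finite group to Z. *)
Lemma sum_cocycle x : \sum_g Phi_lift (f x) g = 0.
Proof.
pose d x := \sum_g Phi_lift (f x) g.
have dM y z : d (y * z)%g = d y + d z.
  rewrite /d -(sum_shift z (Phi_lift (f y))) -big_split /=.
  transitivity (\sum_g (shift z (Phi_lift (f y)) + Phi_lift (f z)) g);
    last first.
    by apply: eq_bigr => g _; rewrite !ffunE.
  by apply: sum_Phi; rewrite PhiD -Phi_act !Phi_liftK fP.
have d1 : d 1%g = 0 by apply/eqP; rewrite -(inj_eq (addrI (d 1%g))) -dM mulg1
  addr0.
have dX n : d (x ^+ n)%g = d x *+ n.
  by elim: n => [|n IH]; rewrite ?expg0 // expgSr dM IH mulrSr.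
have /esym/eqP := dX #[x]%g; rewrite expg_order d1 mulrnz mulf_eq0.
by rewrite eqz_nat (gtn_eqF (order_gt0 x)) orbF => /eqP.
Qed.

(** Expand f(g h) = f(h g) by the cocycle relation. Coset sums do not see the action of h on f(g),
    so those of f(h) g and f(h) agree mod p; g = u^-1 t moves u to t. *)
Lemma csum_const t u :
  (p %| csum (Phi_lift (f h)) t - csum (Phi_lift (f h)) u)%Z.
Proof.
set z := Phi_lift (f h); set g := (u^-1 * t)%g; set y := Phi_lift (f g).
have e : Phi (shift g z + y) = Phi (shift h y + z).
  by rewrite !PhiD -!Phi_act !Phi_liftK -!fP hC.
have := dvdz_csum t e; rewrite !csumD !csum_shift.
have -> : (t * h^-1 = h^-1 * t)%g by rewrite (commuteV (commute_sym (hC t))).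
rewrite -(csum_h _ (h^-1 * t)%g) mulKVg /g invMg invgK mulKVg => d.
suff -> : csum z t - csum z u =
  - (csum z u + csum y t - (csum y t + csum z t)) by rewrite rpredN.
by ring.
Qed.

(* A cocycle vanishing at h takes values in the h-invariants, which are the   *)
(* multiples of the norm element, hence have degree 0 only if zero.           *)
Lemma cocycle_eq0 : f h = ab0 -> forall x, f x = ab0.
Proof.
move=> fh0 x; set y := Phi_lift (f x); rewrite -(Phi_liftK (f x)) -/y.
have e : Phi (shift h y) = Phi y.
  by rewrite -Phi_act Phi_liftK -[RHS]ab0D -[LHS]abD0 -{1}fh0 -fP -hC fP fh0
    gact0.
apply/Phi_ker; split; last exact: sum_cocycle.
have [inv _] := (Phi_ker _).1 (Phi_eq e).
have c0 g : (shift h y - y) g = 0.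
  apply/eqP; have /eqP := csum_inv g inv; rewrite csumB csum_shift.
  have -> : (g * h^-1 = h^-1 * g)%g by rewrite (commuteV (commute_sym (hC g))).
  rewrite -(csum_h _ (h^-1 * g)%g) mulKVg subrr.
  by rewrite eq_sym mulrnz mulf_eq0 eqz_nat (gtn_eqF (prime_gt0 p_pr)) orbF.
move=> g; have := c0 (h * g)%g; rewrite !ffunE [X in (X * _)%g]hC mulgK.
by move/eqP; rewrite subr_eq0 => /eqP.
Qed.

End Cocycle.

Lemma coboundary_of_csum (f : gT -> M) :
  cocycle f -> (p %| csum (Phi_lift (f h)) 1)%Z -> coboundary f.
Proof.
move=> fP; set z := Phi_lift (f h) => p_z1.
have p_z g : (p %| csum z g)%Z.
  by rewrite -[csum z g](subrK (csum z 1)) rpredD // (csum_const fP).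
(* B lies in the kernel of [Phi] and has the same coset sums as z, so z - B still represents f(h)
   and is of the form b h - b. *)
pose B := [ffun g => (csum z g %/ p)%Z].
have BE g : B g *+ p = csum z g by rewrite ffunE mulrnz divzK.
have PhiB0 : Phi B = ab0.
  apply/Phi_ker; split=> [g|]; first by rewrite !ffunE csum_h.
  have /eqP : (\sum_g B g) *+ p = 0.
    rewrite -sumrMnl; under eq_bigr do rewrite BE.
    by rewrite sum_csum (sum_cocycle fP) mul0rn.
  rewrite mulrnz mulf_eq0 eqz_nat (gtn_eqF (prime_gt0 p_pr)) orbF.
  by move/eqP.
have [|b bE] := @csum_eq0_boundary (z - B).
  move=> g; rewrite csumB [csum B g]csum_inv ?BE ?subrr // => y.
  by rewrite !ffunE csum_h.
exists (Phi b); pose d x := abD (gact (Phi b) x) (abN (Phi b)).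
have dP : cocycle d by move=> y t; rewrite /d gactD gactN gactM abDB.
(* F is f minus the coboundary of [Phi b]; it vanishes at h, hence everywhere. *)
pose F : Z1 M := abD (exist _ _ fP : Z1 M) (abN (exist _ _ dP : Z1 M)).
have fE y : f y = abD (sval F y) (d y) by rewrite /= -abDA abND abD0.
move=> x; rewrite fE (cocycle_eq0 (svalP F)) ?ab0D //.
rewrite /= /d Phi_act -PhiB -bE PhiB PhiB0 Phi_liftK.
by rewrite abN0 abD0 abDN.
Qed.


(** The lift y of f(h) = f(g^q) coming from the cocycle relation has coset sums invariant under g.
    Their total is 0 and they all agree mod p, so the index of <g> times one of them is 0 mod p. *)
Lemma csum_cyclic (f : gT -> M) (g : gT) (q : nat) :
    cocycle f -> h = (g ^+ q)%g ->
    ~~ (p %| #|[set: gT] : <[g]>|)%N ->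
  (p %| csum (Phi_lift (f h)) 1)%Z.
Proof.
move=> fP hE p_index; set z := Phi_lift (f g).
pose y := \sum_(i < q) shift (g ^+ i)%g z.
have fy : Phi y = f h.
  rewrite hE /y; elim: (q) => [|n IH]; first by rewrite big_ord0 Phi0
    cocycle_at1.
  rewrite big_ord_recr PhiD IH -Phi_act Phi_liftK.
  by rewrite expgS fP abDC.
have cy t : csum y t = \sum_(i < q) csum z (t * g ^- i)%g.
  rewrite /csum exchange_big; apply: eq_bigr => j _.
  by rewrite sum_ffunE; apply: eq_bigr => i _; rewrite ffunE mulgA.
(* Passing from t to t g gains the term at t g and loses the one at t g^(1-q); these arguments
   differ by g^q = h. *)
have cyg t : csum y (t * g)%g = csum y t.
  rewrite !cy; case: (q) hE => [|n] hE.
    by rewrite !big_ord0.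
  rewrite big_ord_recl [RHS]big_ord_recr addrC /=; congr (_ + _).
    by apply: eq_bigr => i _; rewrite /bump /= add1n expgSr invMg mulgA mulgK.
  rewrite invg1 mulg1 -(csum_h _ (t * g ^- n)%g) hC hE.
  by rewrite expgSr -mulgA mulKg.
have cyX t u : u \in <[g]>%g -> csum y (t * u)%g = csum y t.
  by case/cycleP=> n ->{u}; elim: n => [|n IH];
    rewrite ?mulg1 // expgSr mulgA cyg.
have yfh : Phi y = Phi (Phi_lift (f h)) by rewrite Phi_liftK.
suff : (p %| csum y 1)%Z.
  move=> py; rewrite -[csum _ 1](subrK (csum y 1)) rpredD //.
  by rewrite (dvdz_csum 1%g (esym yfh)).
have py t : (p %| csum y t - csum y 1)%Z.
  suff -> : csum y t - csum y 1 = (csum y t - csum (Phi_lift (f h)) t) +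
     (csum (Phi_lift (f h)) t - csum (Phi_lift (f h)) 1) +
     (csum (Phi_lift (f h)) 1 - csum y 1).
    apply: rpredD; last exact: dvdz_csum (esym yfh).
    by apply: rpredD; [exact: dvdz_csum yfh | exact: csum_const].
  by ring.
have := sum_csum y; rewrite (sum_Phi yfh) (sum_cocycle fP) mul0rn.
rewrite (partition_big (fun t => t *: <[g]>)%g
  (mem (lcosets <[g]> [set: gT]))) /=; last first.
  by move=> t _; apply/imsetP; exists t; rewrite ?inE // lcosetE.
move=> s0; have {s0} : \sum_(c in lcosets <[g]> [set: gT]) csum y (repr c) = 0.
  have /eqP : (\sum_(c in lcosets <[g]> [set: gT]) csum y (repr c)) *+ #[g]%g =
    0.
    rewrite -sumrMnl -[RHS]s0; apply: eq_bigr => _ /lcosetsP[u _ ->].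
    rewrite (eq_bigl (fun t => t \in u *: <[g]>)%g) => [|t]; last first.
      by apply/eqP/idP => [<-|/lcoset_eqP //]; exact: lcoset_refl.
    rewrite /order -(card_lcoset _ u) -sumr_const; apply: eq_bigr => t tu.
    have /lcosetP[v vg ->] : repr (u *: <[g]>)%g \in (t *: <[g]>)%g.
      by rewrite (lcoset_eqP tu) (mem_repr u) ?lcoset_refl.
    by rewrite cyX.
  by rewrite mulrnz mulf_eq0 eqz_nat (gtn_eqF (order_gt0 g)) orbF => /eqP.
move=> s0; have d : (p %| csum y 1 * #|[set: gT] : <[g]>|%:Z)%Z.
  have : (p %| \sum_(c in lcosets <[g]> [set: gT]) (csum y (repr c) - csum y
    1))%Z.
    by apply: rpred_sum => c _.
  by rewrite sumrB s0 sub0r rpredN sumr_const mulrnz card_lcosets.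
by move: d; rewrite !dvdzE abszM Euclid_dvdM //= (negPf p_index) orbF.
Qed.

(** The cocycle F is 1/p times the coboundary of m in M; it exists because the vanishing of the
    transfer makes S(x) divisible by p. *)
Lemma cocycle_of_transfer :
    (forall x : gT, x ^+ #|[set: gT] : <[h]>| = 1)%g ->
  exists2 f : gT -> M, cocycle f & (p %| csum (Phi_lift (f h)) 1 - 1)%Z.
Proof.
move=> xm1.
have /choice[kappa kappaP] : forall g, exists i : nat,
    g = (h ^+ i * repr (<[h]> :* g))%g.
  by move=> g; have [i _ e] := rcos_decomp h g; exists i.
pose S x := (\sum_(c in rcosets <[h]> [set: gT]) kappa (repr c * x^-1)%g)%N.
have p_S x : (p %| S x)%N by rewrite -oh; exact: central_transfer.
pose A x := [ffun g => (kappa (repr (<[h]> :* g) * x^-1))%g%:Z].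
pose m := [ffun g => (kappa g)%:Z].
(* Mod p, the exponent of g x^-1 is that of g plus that of r(g) x^-1, where r(g) represents the
   coset of g. *)
have p_s x g : (p %| (shift x m - m - A x) g)%Z.
  rewrite !ffunE -addrA -opprD -PoszD -eqz_mod_dvd !modz_nat eqz_nat.
  rewrite -oh -eq_expg_mod_order expgD.
  set r := repr (<[h]> :* g)%g.
  have er : repr (<[h]> :* (r * x^-1))%g = repr (<[h]> :* (g * x^-1))%g.
    by rewrite !rcosetM rcoset_repr.
  apply/eqP/(mulIg (repr (<[h]> :* (g * x^-1)))%g).
  by rewrite -kappaP -er -mulgA -kappaP mulgA -kappaP.
(* The H-invariant element A(x) has degree p S(x). Subtracting S(x) times the sum of the p elements
   of H makes the degree 0, hence the second term of F. *)
pose F x := [ffun g => ((shift x m - m - A x) g %/ p)%Z +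
  (S x %/ p)%N%:Z * (g \in <[h]>%g)%:R].
pose Z x := shift x m - m - F x *+ p.
have ZE x g : Z x g = A x g - (S x)%:Z * (g \in <[h]>%g)%:R.
  have -> : Z x g = (shift x m - m) g - F x g *+ p.
    by rewrite !ffunE ffunMnE !ffunE.
  have -> : F x g *+ p = (shift x m - m - A x) g +
       (S x)%:Z * (g \in <[h]>%g)%:R.
    rewrite [F x g]ffunE mulrnDl mulrnz divzK //; congr (_ + _).
    by rewrite -mulrnAl mulrnz -PoszM divnK.
  by rewrite [in RHS]addrC !ffunE; ring.
clearbody F.
have PhiZ x : Phi (Z x) = ab0.
  apply/Phi_ker; split=> [g|].
    by rewrite !ZE !ffunE rcosetM (rcoset_id (cycle_id h)) groupMl ?cycle_id.
  under eq_bigr do rewrite ZE.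
  rewrite sumrB -mulr_sumr.
  have -> : \sum_g ((g \in <[h]>%g)%:R : int) = p%:Z.
    by under eq_bigr do rewrite mulrb; rewrite -big_mkcond /= sumr_const -oh
      natz.
  apply/eqP; rewrite subr_eq0 [X in X == _](partition_big (fun t =>
    <[h]> :* t)%g
    (mem (rcosets <[h]> [set: gT]))) /=; last first.
    by move=> t _; apply/imsetP; exists t; rewrite ?inE // rcosetE.
  rewrite /S -natz natr_sum mulr_suml.
  apply/eqP/eq_bigr => _ /rcosetsP[u _ ->].
  rewrite (eq_bigl (fun t => t \in <[h]> :* u)%g) => [|t]; last first.
    by apply/eqP/idP => [<-|/rcoset_eqP //]; exact: rcoset_refl.
  rewrite natz -mulrnz -oh /order -(card_rcoset _ u) -sumr_const.
  by apply: eq_bigr => t tu; rewrite ffunE (rcoset_eqP tu).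
(* M has no p-torsion, so the cocycle relation for F follows from that for p F, a coboundary. *)
have PhiMn a : Phi (a *+ p) = ab0 -> Phi a = ab0.
  have p0 (n : int) : n *+ p = 0 -> n = 0.
    move/eqP; rewrite mulrnz mulf_eq0 eqz_nat.
    by rewrite (gtn_eqF (prime_gt0 p_pr)) orbF => /eqP.
  case/Phi_ker=> inv s0; apply/Phi_ker; split=> [g|].
    apply/eqP; rewrite -subr_eq0; apply/eqP/p0.
    by rewrite mulrnBl -!ffunMnE inv subrr.
  by apply: p0; rewrite -sumrMnl -[RHS]s0; apply: eq_bigr => g _;
    rewrite ffunMnE.
have fP : cocycle (fun x => Phi (F x)).
  move=> x y; rewrite Phi_act -PhiD.
  apply: (@abDI _ (abN (Phi (shift y (F x) + F y)))).
  rewrite [RHS]abND -PhiN -PhiD; apply: PhiMn.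
  have -> : (- (shift y (F x) + F y) + F (x * y)%g) *+ p =
      shift y (Z x) + Z y - Z (x * y)%g.
    apply/ffunP => g; rewrite /Z !(ffunE, ffunMnE) invMg mulgA.
    by rewrite !mulrnz; ring.
  by rewrite PhiB PhiD -Phi_act !PhiZ gact0 ab0D abDN.
exists (fun x => Phi (F x)) => //.
have := dvdz_csum 1%g (Phi_liftK (Phi (F h))).
move: (csum _ 1) => c; suff : (p %| csum (F h) 1 - 1)%Z.
  by move=> d1 /rpredD/(_ d1); rewrite addrA subrK.
(* The element m h - m has zero coset sums, so Z(h) and -p F(h) have the same ones; those of the
   H-invariant Z(h) are p times its values. *)
have e : csum (F h) 1 = - Z h 1%g.
  have [inv _] := (Phi_ker _).1 (PhiZ h).
  have cMn : csum (F h *+ p) 1 = csum (F h) 1 *+ p.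
    by rewrite -sumrMnl; apply: eq_bigr => i _; rewrite ffunMnE.
  have := csum_inv 1%g inv; rewrite !csumB csum_shift cMn.
  rewrite -(csum_h _ (1 * h^-1)%g) mul1g mulgV subrr sub0r => e.
  apply: (@mulIf _ p%:Z); first by rewrite eqz_nat (gtn_eqF (prime_gt0 p_pr)).
  by rewrite mulNr -!mulrnz -e opprK.
rewrite {}e ZE group1 mulr1 [A h _]ffunE (rcoset_id (group1 _)) repr_group
  mul1g.
rewrite (_ : _ - 1 = (S h)%:Z - (kappa h^-1%g).+1%:Z);
  last by rewrite -addn1 PoszD; ring.
apply: rpredB; first exact: p_S.
(* The representative of H itself is 1, so h^-1 is h to the power [kappa h^-1]. *)
suff d : (p %| (kappa h^-1%g).+1)%N by exact: d.
rewrite -oh order_dvdn expgSr.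
have := kappaP h^-1%g; rewrite rcoset_id ?groupV ?cycle_id // repr_group mulg1.
by move=> <-; rewrite mulVg.
Qed.

Definition cls (f : Z1 M) : H1 M := abproj (@B1 gT M) f.

Lemma cls_surj (c : H1 M) : exists f, c = cls f.
Proof. exact: abproj_surj. Qed.

Lemma cls_eq f f' : cls f = cls f' <-> B1 (abD f (abN f')).
Proof. exact: (abprojP (@B1_0 gT M) (@B1_D gT M) (@B1_N gT M)). Qed.

Lemma H1_cyclic (g : gT) (q : nat) : h = (g ^+ q)%g ->
    ~~ (p %| #|[set: gT] : <[g]>|)%N ->
  forall c : H1 M, c = ab0.
Proof.
move=> hE p_index c; have [f ->] := cls_surj c.
apply/cls_eq; rewrite abN0 abD0.
apply: coboundary_of_csum; first exact: svalP f.
exact: csum_cyclic (svalP f) hE p_index.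
Qed.

Lemma H1_Zp : (forall x : gT, x ^+ #|[set: gT] : <[h]>| = 1)%g ->
  exists f : H1 M -> 'Z_p,
    bijective f /\ {morph f : c d / abD c d >-> c + d}.
Proof.
move=> xm1; have p_gt1 := prime_gt1 p_pr.
have natZp n : (n%:R == 0 :> 'Z_p) = (p %| n)%N.
  by rewrite Zp_nat -val_eqE /= Zp_cast.
have intZp (a : int) : (a%:~R == 0 :> 'Z_p) = (p %| a)%Z.
  case: a => n; rewrite dvdzE; first exact: natZp.
  by rewrite NegzE mulrNz oppr_eq0 abszN; exact: natZp.
have /choice[repC repCK] c : exists f, cls f = c.
  by have [f ->] := cls_surj c; exists f.
pose th (f : Z1 M) : 'Z_p := (csum (Phi_lift (sval f h)) 1)%:~R.
have thP f a : Phi a = sval f h -> th f = (csum a 1)%:~R.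
  move=> e; apply/eqP; rewrite -subr_eq0 -rmorphB /= intZp.
  by apply: dvdz_csum; rewrite Phi_liftK.
have thD f f' : th (abD f f') = th f + th f'.
  rewrite (@thP _ (Phi_lift (sval f h) + Phi_lift (sval f' h))) ?PhiD ?Phi_liftK
    //.
  by rewrite csumD rmorphD.
have thN f : th (abN f) = - th f.
  by rewrite (@thP _ (- Phi_lift (sval f h))) ?PhiN ?Phi_liftK // csumN rmorphN.
have thB f : B1 f -> th f = 0.
  case=> m mE; rewrite (@thP _ (shift h (Phi_lift m) - Phi_lift m)).
    rewrite csumB csum_shift -(csum_h _ (1 * h^-1)%g).
    by rewrite mul1g mulgV subrr.
  by rewrite PhiB -Phi_act Phi_liftK mE.
have th0 f : th f = 0 -> B1 f.
  by move/eqP; rewrite intZp; apply: coboundary_of_csum; exact: svalP f.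
have [f1 f1P] : exists f, th f = 1.
  have [f fP d] := cocycle_of_transfer xm1; exists (exist _ f fP).
  by apply/eqP; rewrite -subr_eq0 -[1]/(1%:~R) -rmorphB /= intZp.
have thcls f f' : cls f = cls f' <-> th f = th f'.
  rewrite cls_eq; split=> [/thB/eqP|e].
    by rewrite thD thN subr_eq0 => /eqP.
  by apply: th0; rewrite thD thN e subrr.
(* The multiples of a class of value 1 give the inverse of theta. *)
pose mulf n := iter n (abD f1) ab0.
have thm n : th (mulf n) = n%:R.
  elim: n => [|n IH]; last by rewrite /mulf iterS thD -/(mulf n) IH f1P mulrS.
  by apply: thB; exact: B1_0.
exists (fun c => th (repC c)); split.
  exists (fun z : 'Z_p => cls (mulf z)) => [c|z].
    by rewrite -[RHS]repCK; apply/thcls; rewrite thm natr_Zp.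
  by rewrite -[RHS]natr_Zp -thm; apply/thcls; exact: repCK.
move=> c d; rewrite -thD; apply/thcls; rewrite repCK.
have := abprojD (@B1_0 gT M) (@B1_D gT M) (@B1_N gT M) (repC c) (repC d).
by rewrite -!/(cls _) !repCK.
Qed.

End Presentation.

(** * Endomorphisms of the multiplicative group *)

(** Units are written additively, so that integral powers are [u *~ n] and products are [\sum]. *)
HB.instance Definition _ (R : comPzRingType) := GRing.isZmodule.Build (units R)
  (@units_mulA R) (@unitsC R) (@units_mul1 R) (@units_mulV R).

Lemma uvalMn (R : comPzRingType) (u : units R) n : uval (u *+ n) = uval u ^+ n.
Proof. by elim: n => [|n IH]; rewrite ?mulr0n // mulrSr exprSr -IH. Qed.

Lemma uval_sum (R : comPzRingType) (I : Type) (r : seq I) (P : pred I)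
    (u : I -> units R) :
  uval (\sum_(i <- r | P i) u i) = \prod_(i <- r | P i) uval (u i).
Proof. exact: big_morph. Qed.

Section Evaluation.
Variables (K : fieldType) (A : calg K) (a : A).

Definition aeval (q : {poly K}) : A := \sum_(i < size q) astr A q`_i * a ^+ i.

Lemma aevalE n (q : {poly K}) : (size q <= n)%N ->
  aeval q = \sum_(i < n) astr A q`_i * a ^+ i.
Proof.
move=> le_qn; rewrite /aeval (big_ord_widen n (fun i =>
  astr A q`_i * a ^+ i)) //.
rewrite big_mkcond; apply: eq_bigr => i _; case: ltnP => // le_qi.
by rewrite nth_default // rmorph0 mul0r.
Qed.

Lemma aevalB : {morph aeval : q r / q - r}.
Proof.
move=> q r; pose n := maxn (size (q - r)) (maxn (size q) (size r)).
rewrite !(@aevalE n) ?leq_max ?leqnn ?orbT // -sumrB.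
by apply: eq_bigr => i _; rewrite coefB rmorphB mulrBl.
Qed.

Lemma aeval0 : aeval 0 = 0.
Proof. by rewrite /aeval size_poly0 big_ord0. Qed.

Lemma aevalD : {morph aeval : q r / q + r}.
Proof.
by move=> q r; rewrite -{1}[r]opprK aevalB -[- r]sub0r aevalB aeval0 sub0r
  opprK.
Qed.

Lemma aevalZ c q : aeval (c *: q) = astr A c * aeval q.
Proof.
rewrite (aevalE (size_scale_leq c q)) mulr_sumr; apply: eq_bigr => i _.
by rewrite coefZ rmorphM mulrA.
Qed.

Lemma aevalMX q : aeval (q * 'X) = aeval q * a.
Proof.
rewrite (@aevalE (size q).+1); last first.
  by have [->|q0] := eqVneq q 0; rewrite ?mul0r ?size_poly0 // size_mulX.
rewrite big_ord_recl coefMX rmorph0 mul0r add0r mulr_suml.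
by apply: eq_bigr => i _; rewrite coefMX exprSr mulrA.
Qed.

Lemma aevalC c : aeval c%:P = astr A c.
Proof. by rewrite (aevalE (size_polyC_leq1 c)) big_ord1 coefC mulr1. Qed.

Lemma aevalM : {morph aeval : q r / q * r}.
Proof.
move=> q r; elim/poly_ind: q => [|q c IH]; first by rewrite !(mul0r, aeval0).
rewrite mulrDl !aevalD mulrAC !aevalMX IH mul_polyC aevalZ aevalC.
by rewrite mulrDl mulrAC.
Qed.

Lemma aevalXn n : aeval 'X^n = a ^+ n.
Proof.
elim: n => [|n IH]; last by rewrite exprSr aevalMX IH exprSr.
by rewrite expr0 /aeval size_poly1 big_ord1 coef1 rmorph1 mulr1.
Qed.
End Evaluation.

(** * Laurent polynomials, the coordinate ring of Gm *)

Section Laurent.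
Variable K : fieldType.
Local Notation F := {fraction {poly K}}.
Local Notation "q %:F" := (tofrac q).
Local Notation t := ('X%:F : F).

(** K[X, 1/X] is realized inside K(X) as the fractions that a power of X turns into polynomials. *)
Definition laurent_pred : pred F :=
  fun x => `[< exists n : nat, exists q : {poly K}, x * t ^+ n = q%:F >].
Definition laurent : Type := {x : F | laurent_pred x}.
HB.instance Definition _ := Choice.on laurent.
HB.instance Definition _ := [isSub of laurent for sval].

Lemma laurentP (x : laurent) : exists n (q : {poly K}), val x * t ^+ n = q%:F.
Proof. exact/asboolP/(valP x). Qed.

Lemma laurent_closed : subring_closed laurent_pred.
Proof.
split=> [|x y /asboolP[n [q xE]] /asboolP[m [r yE]]|
          x y /asboolP[n [q xE]] /asboolP[m [r yE]]]; apply/asboolP.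
- by exists 0%N, 1; rewrite mul1r tofrac1.
- exists (n + m)%N, (q * 'X^m - r * 'X^n).
  by rewrite tofracB !tofracM !tofracXn -xE -yE exprD; ring.
- by exists (n + m)%N, (q * r); rewrite tofracM -xE -yE exprD; ring.
Qed.
HB.instance Definition _ :=
  GRing.SubChoice_isSubComPzRing.Build F laurent_pred laurent laurent_closed.

Lemma laurent_poly_subproof (q : {poly K}) : laurent_pred q%:F.
Proof. by apply/asboolP; exists 0%N, q; rewrite mulr1. Qed.
Definition laurent_poly (q : {poly K}) : laurent :=
  Sub q%:F (laurent_poly_subproof q).

Lemma laurent_const_zmod : zmod_morphism (fun c : K => laurent_poly c%:P).
Proof. by move=> a b; apply: val_inj; rewrite /= polyCB tofracB. Qed.
Lemma laurent_const_monoid : monoid_morphism (fun c : K => laurent_poly c%:P).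
Proof.
split=> [|a b]; apply: val_inj; first by rewrite /= polyC1 tofrac1.
by rewrite /= polyCM tofracM.
Qed.
Definition laurent_const : K -> laurent := fun c => laurent_poly c%:P.
HB.instance Definition _ :=
  GRing.isZmodMorphism.Build K laurent laurent_const laurent_const_zmod.
HB.instance Definition _ :=
  GRing.isMonoidMorphism.Build K laurent laurent_const laurent_const_monoid.
Definition laurent_alg : calg K := @CAlg K laurent laurent_const.

Lemma t_neq0 : t != 0.
Proof. by rewrite tofrac_eq0 polyX_eq0. Qed.

Lemma laurent_Vt_subproof : laurent_pred t^-1.
Proof. by apply/asboolP; exists 1%N, 1; rewrite mulVf ?t_neq0 // tofrac1. Qed.
Lemma laurent_t_mulV :
  laurent_poly 'X * (Sub t^-1 laurent_Vt_subproof : laurent) = 1.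
Proof. by apply: val_inj; rewrite /= divff ?t_neq0. Qed.
Definition laurent_t : units laurent_alg := Units laurent_t_mulV.

Section LaurentEvaluation.
Variables (A : calg K) (u : units A).

Definition leval (x : laurent) : A :=
  let: exist n np := cid (laurentP x) in
  aeval (uval u) (sval (cid np)) * uinv u ^+ n.

(** The value does not depend on how x is written as q / X^n: cross-multiply, evaluate, and cancel
    powers of the unit u. *)
Lemma levalE (x : laurent) n (q : {poly K}) :
  val x * t ^+ n = q%:F -> leval x = aeval (uval u) q * uinv u ^+ n.
Proof.
rewrite /leval; case: cid => m np; case: cid => r /= xr xq.
have e : r * 'X^n = q * 'X^m.
  by apply/eqP; rewrite -tofrac_eq !tofracM !tofracXn -xr -xq; apply/eqP; ring.
have /(congr1 (aeval (uval u))) := e; rewrite !aevalM !aevalXn => {}e.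
have uK i : uval u ^+ i * uinv u ^+ i = 1 by rewrite -exprMn uvalK expr1n.
rewrite -[aeval _ r]mulr1 -(uK n) mulrA e -[aeval _ q in RHS]mulr1 -(uK m).
by ring.
Qed.

Lemma leval_zmod : zmod_morphism leval.
Proof.
move=> x y; have [n [q xE]] := laurentP x; have [m [r yE]] := laurentP y.
rewrite (levalE xE) (levalE yE) (@levalE _ (n + m) (q * 'X^m - r * 'X^n)).
  rewrite aevalB !aevalM !aevalXn exprD.
  have uK i : uval u ^+ i * uinv u ^+ i = 1 by rewrite -exprMn uvalK expr1n.
  rewrite mulrBl; congr (_ - _).
    by rewrite -[RHS]mulr1 -(uK m); ring.
  by rewrite -[RHS]mulr1 -(uK n); ring.
by rewrite tofracB !tofracM !tofracXn -xE -yE exprD /=; ring.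
Qed.

Lemma leval_monoid : monoid_morphism leval.
Proof.
split=> [|x y].
  rewrite (@levalE _ 0 'X^0); first by rewrite aevalXn mulr1.
  by rewrite mul1r tofracXn.
have [n [q xE]] := laurentP x; have [m [r yE]] := laurentP y.
rewrite (levalE xE) (levalE yE) (@levalE _ (n + m) (q * r)).
  by rewrite aevalM exprD; ring.
by rewrite tofracM -xE -yE exprD /=; ring.
Qed.
HB.instance Definition _ :=
  GRing.isZmodMorphism.Build laurent A leval leval_zmod.
HB.instance Definition _ :=
  GRing.isMonoidMorphism.Build laurent A leval leval_monoid.

Lemma leval_const (c : K) : leval (astr laurent_alg c) = astr A c.
Proof.
by rewrite (@levalE _ 0 c%:P) ?mulr1 // aevalC.
Qed.
Definition leval_hom : ahom laurent_alg A := 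
  @AHom K laurent_alg A leval leval_const.
Lemma leval_t : gmap (Gm K) leval_hom laurent_t = u.
Proof.
apply: uval_inj; rewrite /uval /= (@levalE _ 0 'X) ?mulr1 //.
by rewrite -['X]expr1 aevalXn.
Qed.
End LaurentEvaluation.

(** The numerators of x and of its inverse multiply to a power of X, so each is a constant times a
    power of X. *)
Lemma laurent_units (x : units laurent_alg) :
  exists c n m, val (uval x) * t ^+ n = (c *: 'X^m)%:F.
Proof.
have [n [q xE]] := laurentP (uval x); have [m [r yE]] := laurentP (uinv x).
have qr : q * r = 'X^(n + m).
  apply/eqP; rewrite -tofrac_eq tofracM tofracXn -xE -yE; apply/eqP.
  have /(congr1 val) /= e := uvalK x.
  by rewrite mulrACA e mul1r exprD.
have : q %| ('X - 0%:P) ^+ (n + m) by rewrite subr0 -qr dvdp_mulr.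
case/dvdp_exp_XsubCP => k _; rewrite subr0 => /eqpf_eq[c _ qE].
by exists c, n, k; rewrite xE qE.
Qed.

(* By naturality the value on the generic unit 'X of the Laurent polynomial   *)
(* ring determines all others; it is a monomial, of coefficient 1 since phi   *)
(* maps 1 to 1.                                                               *)
Lemma Gm_end (phi : ghom (Gm K) (Gm K)) :
  exists n : int, forall (A : calg K) (u : units A), phi A u = u *~ n.
Proof.
have [c [n [m fE]]] := laurent_units (phi laurent_alg laurent_t).
have phiE (A : calg K) (u : units A) :
    uval (phi A u) = astr A c * uval u ^+ m * uinv u ^+ n.
  rewrite -{1}(leval_t u) gfun_nat.
  by rewrite [LHS](levalE u fE) aevalZ aevalXn.
have c1 : c = 1.
  pose A := @CAlg K K idfun.
  have := phiE A 1%g; rewrite (ghomf1 (@gfunM _ _ _ phi A)) /=.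
  by rewrite !expr1n !mulr1 => <-.
exists (m%:Z - n%:Z) => A u; apply: uval_inj.
rewrite phiE c1 rmorph1 mul1r mulrzBr -!pmulrn.
rewrite -[RHS]/(uval (u *+ m) * uinv (u *+ n)) uvalMn; congr (_ * _).
by elim: n {fE phiE} => [|n IH]; rewrite ?mulr0n // exprSr mulrSr IH.
Qed.

End Laurent.

(** * Points and characters of the torus *)

Lemma mulmx1_sym (R : comNzRingType) (m n : nat) (X : 'M[R]_(m, n)) (Y : 'M_(n,
  m)) :
  m = n -> X *m Y = 1%:M -> Y *m X = 1%:M.
Proof. by move=> mn; case: _ / mn in X Y *; exact: mulmx1C. Qed.

Lemma morph_unitsMz (R S : comPzRingType) (f : units R -> units S) :
  {morph f : x y / (x * y)%g} -> forall x n, f (x *~ n) = f x *~ n.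
Proof.
move=> fM x n; have fMn i : f (x *+ i) = f x *+ i.
  elim: i => [|i IH]; first exact: (ghomf1 fM).
  by rewrite !mulrS -IH; exact: fM.
case: n => n; first by rewrite -!pmulrn fMn.
by rewrite NegzE !mulrNz -!pmulrn -fMn; exact: (ghomfV fM).
Qed.

(** * Splitting of the tensor product over K *)

Section SplitTensor.
Variables (k : fieldType) (K : splittingFieldType k).
Local Notation G := (gal_of {:K}).
Local Notation e := (vbasis {:K}).
Local Notation n := (\dim {:K}).

Section TensorEvaluation.
Variable A : calg K.
Local Notation tensA := (tens K (restr A)).

(** The coordinate of index g of the splitting of A (x) K as A^G: a (x) b goes to a g(b). *)
Definition tev (g : G) (x : tensA) : A := \sum_i x 0 i * astr A (g e`_i).

Lemma tevB g : {morph tev g : x y / x - y}.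
Proof.
move=> x y; rewrite /tev -sumrB; apply: eq_bigr => i _.
by rewrite !mxE mulrBl.
Qed.

Lemma tev0 g : tev g 0 = 0.
Proof. by rewrite -(subrr 0) tevB subrr. Qed.

Lemma tevD g : {morph tev g : x y / x + y}.
Proof.
move=> x y; rewrite /tev -big_split /=; apply: eq_bigr => i _.
by rewrite !mxE mulrDl.
Qed.

Lemma tevZ g (c : A) x : tev g (c *: x) = c * tev g x.
Proof.
by rewrite /tev mulr_sumr; apply: eq_bigr => i _; rewrite mxE mulrA.
Qed.

Lemma tev_sum g (I : Type) (r : seq I) (P : pred I) (f : I -> tensA) :
  tev g (\sum_(i <- r | P i) f i) = \sum_(i <- r | P i) tev g (f i).
Proof. exact: (big_morph (tev g) (tevD g) (tev0 g)). Qed.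

Lemma tev_tin g (a : K) : tev g (tin (restr A) a) = astr A (g a).
Proof.
rewrite [in RHS](basis_expand a) !linear_sum /= rmorph_sum;
  apply: eq_bigr => i _.
by rewrite mxE /= -rmorphM linearZ /= mulr_algl.
Qed.

Lemma tev1 g : tev g 1 = 1.
Proof. by rewrite tev_tin !rmorph1. Qed.

Lemma tevM g : {morph tev g : x y / x * y}.
Proof.
move=> x y; rewrite -[x * y]/(tmul x y) /tmul tev_sum mulr_suml.
apply: eq_bigr => i _; rewrite tev_sum mulr_sumr; apply: eq_bigr => j _.
by rewrite tevZ tev_tin !rmorphM mulrACA.
Qed.

Lemma tev_tscal g (c : A) : tev g (@tscal k K (restr A) c) = c.
Proof. by rewrite tevZ tev1 mulr1. Qed.

Lemma tev_tmap g (h : G) x : tev g (tmap h x) = tev (h * g)%g x.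
Proof.
rewrite tev_sum; apply: eq_bigr => i _.
by rewrite tevZ tev_tin galM ?memvf.
Qed.

Lemma tev_prod g (I : Type) (r : seq I) (P : pred I) (f : I -> tensA) :
  tev g (\prod_(i <- r | P i) f i) = \prod_(i <- r | P i) tev g (f i).
Proof. exact: (big_morph (tev g) (tevM g) (tev1 g)). Qed.
End TensorEvaluation.

Definition gmx : 'M[K]_(#|{: G}|, n) := \matrix_(j, i) (enum_val j : G) e`_i.

(** A linear relation between the rows is one between the automorphisms, which are independent by
    Dedekind. *)
Lemma gmx_inv : exists U : 'M_(n, #|{: G}|), gmx *m U = 1%:M.
Proof.
apply/row_freeP/inj_row_free => v v0.
have vE (a : K) : a \in {:K}%VS -> \sum_(g : G) v 0 (enum_rank g) * g a = 0.
  move=> _; rewrite (basis_expand a).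
  under eq_bigr do rewrite linear_sum mulr_sumr.
  rewrite exchange_big big1 // => i _.
  transitivity ((coord e i a)%:A * (v *m gmx) 0 i);
    last by rewrite v0 mxE mulr0.
  rewrite mxE mulr_sumr [RHS](reindex_onto enum_rank enum_val) /=; last first.
    by move=> j _; rewrite enum_valK.
  apply: eq_big => [g|g _]; first by rewrite enum_rankK eqxx.
  by rewrite mxE enum_rankK linearZ /= mulr_algl scalerAr.
apply/rowP=> j; rewrite mxE -(enum_valK j).
exact: (gal_independent vE).
Qed.

Hypothesis galK : galois 1 {:K}.

Lemma card_gal : #|{: G}| = n.
Proof. by have := galois_dim galK; rewrite dimv1 divn1 gal_setT cardsT =>
  ->. Qed.

Section Points.
Variable A : calg K.
Local Notation tensA := (tens K (restr A)).

Lemma tev_inj (x y : tensA) : (forall g, tev g x = tev g y) -> x = y.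
Proof.
have [U /(mulmx1_sym card_gal) UgE] := gmx_inv.
have xE (z : tensA) i :
    z 0 i = \sum_(g : G) astr A (U i (enum_rank g)) * tev g z.
  under eq_bigr do rewrite mulr_sumr.
  have inner l : \sum_(g : G) astr A (U i (enum_rank g)) *
      (z 0 l * astr A (g e`_l)) = z 0 l *+ (i == l).
    transitivity (z 0 l * astr A ((U *m gmx) i l)); last first.
      by rewrite UgE mxE rmorph_nat mulr_natr.
    rewrite mxE rmorph_sum mulr_sumr.
    rewrite [RHS](reindex_onto enum_rank enum_val) /=; last first.
      by move=> j _; rewrite enum_valK.
    apply: eq_big => [g|g _]; first by rewrite enum_rankK eqxx.
    by rewrite mxE enum_rankK rmorphM mulrCA.
  rewrite exchange_big /= (eq_bigr _ (fun l _ => inner l)).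
  rewrite (bigD1 i) //= eqxx big1 ?addr0 // => l.
  by rewrite eq_sym => /negPf->.
move=> xy; apply/rowP=> i; rewrite !xE.
by apply: eq_bigr => g _; rewrite xy.
Qed.

Lemma tev_surj (a : G -> A) : exists x : tensA, forall g, tev g x = a g.
Proof.
have [U gUE] := gmx_inv.
exists (\row_i \sum_(g : G) a g * astr A (U i (enum_rank g))) => h.
rewrite /tev; under eq_bigr do rewrite mxE mulr_suml.
have inner g : \sum_i a g * astr A (U i (enum_rank g)) * astr A (h e`_i) =
    a g *+ (g == h).
  transitivity (a g * astr A ((gmx *m U) (enum_rank h) (enum_rank g))).
    rewrite mxE rmorph_sum mulr_sumr; apply: eq_bigr => i _.
    by rewrite mxE enum_rankK rmorphM mulrAC mulrA.
  by rewrite gUE mxE (inj_eq enum_rank_inj) eq_sym rmorph_nat mulr_natr.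
rewrite exchange_big /= (eq_bigr _ (fun g _ => inner g)).
by rewrite (bigD1 h) //= eqxx big1 ?addr0 // => g /negPf->.
Qed.
End Points.

Section TorusPoints.
Variables (E : {subfield K}) (galE : galois E {:K}).
Local Notation H := 'Gal({:K} / E)%g.
Local Notation T := (torus E galE).

(** In the coordinates [tev], the norm to E is the product over a coset of H, and x (x) 1 is the
    constant family x. *)
Lemma norm_quotP (A : calg K) (z : gprod (Gm k) (weil (Gm K)) (restr A)) :
  reflect (forall g : G, uval z.1 = \prod_(h in H) tev (h * g)%g (uval z.2))
    (gker_pred (norm_quot galE) z).
Proof.
have tz : tmap vsval (tscal (subvs_of E) (uval z.1)) =
    tscal K (uval z.1) :> tens K (restr A).
  by apply: tmap_tscal; exact: algid1.
have -> : gker_pred (norm_quot galE) z =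
    (units_map (@tscal1 _ _ _) (@tscalM _ _ _) z.1 ==
     units_map (@tnorm1 _ _ _ galE _) (@tnormM _ _ _ galE _) z.2).
  rewrite /gker_pred /= /norm_quot_fun; set a := units_map _ _ _;
    set b := units_map _ _ _.
  apply/eqP/eqP => [e|->]; last exact: mulVg.
  by rewrite -[b](mulKVg a) e mulg1.
have -> : forall a b : units (tens (subvs_of E) (restr A)),
    (a == b) = (tmap vsval (uval a) == tmap vsval (uval b)).
  by move=> a b; rewrite (inj_eq (@tmap_vsval_inj _ _ _ _)) (inj_eq (@uval_inj
    _)).
rewrite (_ : tmap vsval (uval (units_map _ _ z.1)) =
  tmap vsval (tscal (subvs_of E) (uval z.1))) // tz.
rewrite (_ : tmap vsval (uval (units_map _ _ z.2)) =
  tmap vsval (tnorm E (uval z.2))) // tnormE //.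
apply: (iffP eqP) => [e g|zE]; last first.
  apply: tev_inj => g; rewrite tev_tscal (zE g) tev_prod.
  by apply: eq_bigr => h _; rewrite tev_tmap.
rewrite -[LHS](tev_tscal g) e tev_prod.
by apply: eq_bigr => h _; rewrite tev_tmap.
Qed.

Definition tpair (A : calg K) (t : bc K T A) :
  gprod (Gm k) (weil (Gm K)) (restr A) := sval (t : gker_pts _ _).

Definition tcoord_fun (g : G) (A : calg K) (t : bc K T A) : Gm K A :=
  units_map (@tev1 A g) (@tevM A g) (tpair t).2.
Lemma tcoord_funM g A (s t : bc K T A) :
  tcoord_fun g (s * t)%g = (tcoord_fun g s * tcoord_fun g t)%g.
Proof. exact: (units_mapM (@tev1 A g) (@tevM A g)). Qed.
Lemma tcoord_fun_nat g (A B : calg K) (f : ahom A B) (t : bc K T A) :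
  tcoord_fun g (gmap (bc K T) f t) = gmap (Gm K) f (tcoord_fun g t).
Proof.
apply: uval_inj; rewrite /uval /= /tev rmorph_sum; apply: eq_bigr => i _.
by rewrite mxE rmorphM ahomE.
Qed.
Definition tcoord g : ghom (bc K T) (Gm K) :=
  GHom (@tcoord_funM g) (@tcoord_fun_nat g).

Lemma tbaseE (A : calg K) (t : bc K T A) (g : G) :
  (tpair t).1 = \sum_(h in H) (tcoord (h * g)%g A t : units A).
Proof.
apply: uval_inj; rewrite uval_sum.
exact: (norm_quotP _ (valP (t : gker_pts _ _))).
Qed.

Lemma tcoord_inj (A : calg K) (s t : bc K T A) :
  (forall g, tcoord g A s = tcoord g A t) -> s = t.
Proof.
move=> st; apply: val_inj.
rewrite -[LHS]/(tpair s) -[RHS]/(tpair t) [tpair s]surjective_pairing.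
rewrite [RHS]surjective_pairing; congr pair.
  by rewrite !(tbaseE _ 1%g); apply: eq_bigr => h _; rewrite st.
apply: uval_inj; apply: tev_inj => g; exact: (congr1 (@uval _) (st g)).
Qed.

Lemma tcoord_surj (A : calg K) (x : units A) (y : G -> units A) :
    (forall g, \sum_(h in H) y (h * g)%g = x) ->
  exists t : bc K T A, forall g, tcoord g A t = y g.
Proof.
move=> yx; have [a aE] := @tev_surj A (fun g => uval (y g)).
have [b bE] := @tev_surj A (fun g => uinv (y g)).
have ab : a * b = 1 :> tens K (restr A).
  by apply: tev_inj => g; rewrite tevM aE bE uvalK tev1.
have zP : gker_pred (norm_quot galE) ((x, Units ab) :
  gprod (Gm k) (weil (Gm K)) (restr A)).
  apply/norm_quotP => g /=; rewrite -[in LHS](yx g) uval_sum.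
  by apply: eq_bigr => h _; rewrite aE.
exists (exist (@gker_pred _ _ _ (norm_quot galE) _) _ zP) => g.
apply: uval_inj; exact: aE.
Qed.


(** The condition for u |-> (u^w(g))_g to land in the torus. *)
Definition cochar_ok (w : G -> int) :=
  forall g, \sum_(h in H) w (h * g)%g = \sum_(h in H) w h.

Section Cocharacter.
Variable w : G -> int.
Hypothesis wP : cochar_ok w.

Lemma cochar_subproof (A : calg K) (u : units A) :
  exists t : bc K T A, forall g, tcoord g A t = u *~ w g.
Proof.
apply: (@tcoord_surj A (u *~ \sum_(h in H) w h)) => g.
by rewrite -(wP g) -mulrz_sumr.
Qed.
Definition cochar_fun (A : calg K) (u : Gm K A) : bc K T A :=
  sval (cid (cochar_subproof u)).
Lemma cochar_funE (A : calg K) (u : units A) g :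
  tcoord g A (cochar_fun u) = u *~ w g.
Proof. by rewrite /cochar_fun; case: cid. Qed.

Lemma cochar_funM (A : calg K) (u v : Gm K A) :
  cochar_fun (u * v)%g = (cochar_fun u * cochar_fun v)%g.
Proof.
apply: tcoord_inj => g; rewrite gfunM !cochar_funE.
exact: (mulrzDl _ (u : units A) v).
Qed.
Lemma cochar_fun_nat (A B : calg K) (f : ahom A B) (u : Gm K A) :
  cochar_fun (gmap (Gm K) f u) = gmap (bc K T) f (cochar_fun u).
Proof.
apply: tcoord_inj => g; rewrite gfun_nat !cochar_funE; symmetry.
exact: (morph_unitsMz (gmapM (Gm K) f)).
Qed.
Definition cochar : ghom (Gm K) (bc K T) := GHom cochar_funM cochar_fun_nat.
End Cocharacter.

Section Character.
Variable a : {ffun G -> int}.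
Definition torus_char_fun (A : calg K) (t : bc K T A) : Gm K A :=
  \sum_(g : G) (tcoord g A t : units A) *~ a g.
Lemma torus_char_funM (A : calg K) (s t : bc K T A) :
  torus_char_fun (s * t)%g = (torus_char_fun s * torus_char_fun t)%g.
Proof.
rewrite -[RHS]/(torus_char_fun s + torus_char_fun t :> units A) -big_split /=.
apply: eq_bigr => g _; rewrite -mulrzDl; congr (_ *~ _).
exact: (@gfunM _ _ _ (tcoord g) A s t).
Qed.
Lemma torus_char_fun_nat (A B : calg K) (f : ahom A B) (t : bc K T A) :
  torus_char_fun (gmap (bc K T) f t) = gmap (Gm K) f (torus_char_fun t).
Proof.
have fM := gmapM (Gm K) f.
rewrite /torus_char_fun; rewrite [RHS](big_morph (gmap (Gm K) f : units A ->
  units B) fM (ghomf1 fM)).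
apply: eq_bigr => g _; rewrite gfun_nat; symmetry.
exact: (morph_unitsMz fM).
Qed.
Definition torus_char : chars K T := GHom torus_char_funM torus_char_fun_nat.
End Character.

Lemma torus_charB a b :
  torus_char (a - b) = charD (torus_char a) (charN (torus_char b)).
Proof.
apply: chars_ext => A t; rewrite /= /torus_char_fun.
rewrite -[RHS]/(_ - _ : units A) -sumrB; apply: eq_bigr => g _.
by rewrite !ffunE mulrzBr.
Qed.

Lemma torus_char_act a (s : G) :
  char_act (torus_char a) s = torus_char (shift s a).
Proof.
apply: chars_ext => A t; rewrite /= /char_act_fun /= /torus_char_fun.
rewrite [RHS](reindex_inj (mulIg s)) /=; apply: eq_bigr => g _.
rewrite ffunE mulgK; congr (_ *~ _); apply: uval_inj.
rewrite /uval /= /tev; apply: eq_bigr => i _.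
by rewrite mxE /= galM ?memvf.
Qed.

Lemma torus_char_cochar a w (wP : cochar_ok w)
    (A : calg K) (u : units A) :
  torus_char a A (cochar wP A u) = u *~ \sum_(g : G) w g * a g.
Proof.
rewrite /= /torus_char_fun mulrz_sumr; apply: eq_bigr => g _.
by rewrite [tcoord _ _ _]cochar_funE mulrzA.
Qed.


Lemma cochar_diff (k0 h0 : G) : h0 \in H ->
  cochar_ok (fun g => (g == k0)%:R - (g == h0 * k0)%g%:R).
Proof.
move=> h0H; suff e g : \sum_(h in H)
    ((h * g == k0)%g%:R - (h * g == h0 * k0)%g%:R : int) = 0.
  move=> g; rewrite e -[LHS](e 1%g).
  by apply: eq_bigr => h _; rewrite mulg1.
rewrite sumrB [X in _ - X](reindex_inj (mulgI h0)) /=.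
apply/eqP; rewrite subr_eq0; apply/eqP/eq_big => [h|h _].
  by rewrite groupMl.
by rewrite -mulgA (inj_eq (mulgI h0)).
Qed.

(** A trivial character pairs to 0 with every cocharacter, as seen on a unit of infinite order: the
    differences [cochar_diff] give H-invariance, the constant 1 gives degree 0. Conversely, an
    H-invariant a gives the common coset product to the power of the sum of a over coset
    representatives, which is 0. *)
Lemma torus_char_eq0 (a : {ffun G -> int}) :
    (exists u : units K, forall n, u *~ n = 0 -> n = 0) ->
  torus_char a = char0 K T <->
    (forall h g, h \in H -> a (h * g)%g = a g) /\ \sum_g a g = 0.
Proof.
case=> u u0; split=> [a0|[ah s0]].
  have w0 w : cochar_ok w -> \sum_(g : G) w g * a g = 0.
    move=> wP; apply: u0; rewrite -(torus_char_cochar a wP (A := CAlg (idfun :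
      {rmorphism K -> K})) u).
    by rewrite a0.
  split=> [h g hH|].
    have := w0 _ (cochar_diff g hH).
    under eq_bigr do rewrite mulrBl !mulr_natl !mulrb.
    by rewrite sumrB -!big_mkcond !big_pred1_eq => /eqP;
      rewrite subr_eq0 => /eqP.
  rewrite -[RHS](w0 (fun=> 1)) => [|g //].
  by apply: eq_bigr => g _; rewrite mul1r.
have ac : \sum_(c in rcosets H [set: G]) a (repr c) = 0.
  have := s0; rewrite (sum_rcosets 'Gal({:K} / E)%G).
  under eq_bigr => c _ do under eq_bigr => h hH do rewrite ah //.
  under eq_bigr => c _ do rewrite sumr_const.
  rewrite sumrMnl => /eqP; rewrite mulrnz mulf_eq0 eqz_nat.
  by rewrite (gtn_eqF (cardG_gt0 _)) orbF => /eqP.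
apply: chars_ext => A t; rewrite /= /torus_char_fun.
rewrite (sum_rcosets 'Gal({:K} / E)%G).
under eq_bigr => c _ do under eq_bigr => h hH do rewrite ah //.
under eq_bigr => c _ do rewrite -mulrz_suml -tbaseE.
by rewrite -mulrz_sumr ac mulr0z.
Qed.

Lemma char_cochar (chi : chars K T) w (wP : cochar_ok w) :
  exists n : int, forall (A : calg K) (u : units A),
    chi A (cochar wP A u) = u *~ n.
Proof.
have cM (A : calg K) (u v : Gm K A) : chi A (cochar wP A (u * v)%g) =
    (chi A (cochar wP A u) * chi A (cochar wP A v))%g.
  by rewrite !gfunM.
have cN (A B : calg K) (f : ahom A B) (u : Gm K A) :
    chi B (cochar wP B (gmap (Gm K) f u)) =
      gmap (Gm K) f (chi A (cochar wP A u)).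
  by rewrite !gfun_nat.
exact: (Gm_end (GHom cM cN)).
Qed.

(** A point is a product of values of cocharacters at its own coordinates and at its common coset
    product x, and chi is a power map on each of them. As x is the product of the coordinates in H,
    its exponent n0 is added there. *)
Lemma torus_char_surj (chi : chars K T) : exists a, torus_char a = chi.
Proof.
pose r (g : G) := repr (H :* g)%g.
have rH g : (r g * g^-1 \in H)%g by rewrite -mem_rcoset; exact: mem_repr_rcoset.
have w0P : cochar_ok (fun g => (g == r g)%:R).
  suff e g : \sum_(h in H) ((h * g == r (h * g))%g%:R : int) = 1.
    move=> g; rewrite e -[LHS](e 1%g).
  by apply: eq_bigr => h _; rewrite mulg1.
  rewrite (bigD1 (r g * g^-1)%g) //= big1 ?addr0 => [|h /andP[hH /eqP hn]].
    by rewrite /r rcosetM (rcoset_id (rH g)) mulgKV eqxx.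
  rewrite /r rcosetM rcoset_id //; case: eqP => // e.
  by case: hn; rewrite /r -e mulgK.
have [n0 n0E] := char_cochar chi w0P.
have /choice[m mE] k0 := char_cochar chi (cochar_diff k0 (rH k0)).
exists [ffun g => m g + (g \in H)%:R * n0].
apply: chars_ext => A t.
have prodE s : exists2 t' : bc K T A,
    forall g, tcoord g A t' = \sum_(k0 <- s) (tcoord k0 A t : units A) *~
      ((g == k0)%:R - (g == r k0 * k0^-1 * k0)%g%:R) &
    chi A t' = \sum_(k0 <- s) (tcoord k0 A t : units A) *~ m k0.
  elim: s => [|k0 s [t' t'E chiE]].
    exists 1%g => [g|]; rewrite big_nil; exact: (ghomf1 (@gfunM _ _ _ _ A)).
  exists (cochar (cochar_diff k0 (rH k0)) A (tcoord k0 A t) * t')%g => [g|].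
    by rewrite big_cons -t'E gfunM [tcoord g A (cochar _ _ _)]cochar_funE.
  by rewrite big_cons -chiE gfunM mE.
have [t' t'E chiE] := prodE (index_enum G).
have mulrzb (x : units A) (b : bool) : x *~ b%:R = if b then x else 0.
  by case: b; rewrite ?mulr1z ?mulr0z.
(* At a coset representative, the factor x cancels the inverses of all coordinates in the coset;
   elsewhere only the factor k0 = g contributes. *)
have tE : t = (cochar w0P A (tpair t).1 * t')%g.
  apply: tcoord_inj => g; rewrite gfunM [tcoord g A (cochar _ _ _)]cochar_funE
    t'E.
  rewrite -[RHS]/(_ + _ : units A) mulrzb.
  under eq_bigr do rewrite mulgKV mulrzBr !mulrzb.
  rewrite sumrB -!big_mkcond (big_pred1 g) => [|k0]; last exact: eq_sym.
  rewrite (_ : \sum_(k0 | g == r k0) _ = if g == r g then (tpair t).1 else 0).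
    by rewrite addrCA subrr addr0.
  have [gr|gr] := eqVneq g (r g); last first.
    rewrite big_pred0 // => k0; apply: contraNF gr => /eqP->.
    by rewrite /r rcoset_repr.
  rewrite (tbaseE t g) (reindex_inj (mulIg g)); apply: eq_bigl => h /=.
  apply/eqP/idP => [e|hH]; last by rewrite /r rcosetM (rcoset_id hH).
  have := rcoset_refl H (h * g)%g.
  by rewrite -(rcoset_repr H (h * g)) -/(r _) -e mem_rcoset mulgK.
rewrite [in RHS]tE gfunM n0E chiE /= /torus_char_fun.
under [LHS]eq_bigr do rewrite ffunE mulrzDr mulrzA mulrzb.
rewrite big_split -[RHS]/(_ + _ : units A) addrC; congr (_ + _).
rewrite (tbaseE t 1%g) mulrz_suml [RHS]big_mkcond; apply: eq_bigr => g _.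
by rewrite mulg1; case: ifP; rewrite ?mul0rz.
Qed.
End TorusPoints.
End SplitTensor.

(** * Cyclic Sylow subgroups and the conclusion *)

Lemma cyclic_Sylow_of_expg (gT : finGroupType) (G H : {group gT}) (p : nat)
    (x : gT) :
    prime p -> H \subset G -> #|H| = p -> x \in G -> (x ^+ #|G : H| != 1)%g ->
  forall P : {group gT}, P \in 'Syl_p(G) -> cyclic P.
Proof.
move=> p_pr sHG oH xG xm P; rewrite inE => sylP.
have sxG : <[x]>%g \subset G by rewrite cycle_subG.
(* Since p (G : H) is the order of x times (G : <x>), if p divided the latter then the order of x
   would divide (G : H). *)
have p'i : ~~ (p %| #|G : <[x]>|)%N.
  apply: contra xm => /dvdnP[d e]; rewrite -order_dvdn; apply/dvdnP; exists d.
  apply/eqP; rewrite -(eqn_pmul2l (prime_gt0 p_pr)) -{1}oH Lagrange //.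
  by rewrite -(Lagrange sxG) e mulnC -mulnA mulnCA.
(* Hence a Sylow p-subgroup of <x>, which is cyclic, is one of G. *)
have [Q sylQ] := Sylow_exists p <[x]>%G.
have sylQG : p.-Sylow(G) Q.
  have [sQx pQ p'Q] := and3P sylQ.
  apply/and3P; split=> //; first exact: subset_trans sxG.
  rewrite -(Lagrange_index sxG sQx) pnatM p'Q andbT.
  by rewrite p'natE.
have [g gG ->] := Sylow_trans sylQG sylP.
by rewrite cyclicJ; apply: cyclicS (cycle_cyclic x); exact: pHall_sub sylQ.
Qed.

Lemma unit2_infinite_order (k : fieldExtType rat) (K : splittingFieldType k) :
  exists u : units K, forall n, u *~ n = 0 -> n = 0.
Proof.
have char0 : forall n, (n%:R == 0 :> K) = (n == 0)%N.
  by apply/pcharf0P => q; rewrite !pchar_lalg Num.Theory.pchar_num.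
have two : (2%:R : K) / 2%:R = 1 by rewrite divff // char0.
exists (Units two).
have inj n : (Units two) *+ n = 0 -> n = 0%N.
  move/(congr1 (@uval _)); rewrite uvalMn /= => /eqP.
  have e : (2 ^ n - 1)%N%:R = 2%:R ^+ n - 1 :> K by rewrite natrB ?expn_gt0 //
    natrX.
  rewrite -subr_eq0 -[X in X == 0]e char0 subn_eq0.
  by rewrite -[1%N]/(2 ^ 0)%N leq_exp2l // leqn0 => /eqP.
case=> n; first by rewrite -pmulrn => /inj->.
by rewrite NegzE mulrNz -pmulrn => /eqP; rewrite oppr_eq0 => /eqP/inj.
Qed.

(** Number fields enter only through a unit of infinite order in K, for which 2 serves. *)
Lemma H1_norm_torus (k : fieldType) (K : splittingFieldType k)
    (E : {subfield K})
    (galE : galois E {:K}) (H : {group gal_of {:K}}) (p : nat) :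
    'Gal({:K} / E)%g = H ->
    (exists u : units K, forall n, u *~ n = 0 -> n = 0) ->
    galois 1 {:K} -> prime p -> H \subset 'Z('Gal({:K} / 1)) -> #|H| = p ->
  let H1X := H1 (char_module K (torus E galE)) in
  let cyclic_Sylow := forall P : {group gal_of {:K}},
    P \in 'Syl_p('Gal({:K} / 1)) -> cyclic P in
  (cyclic_Sylow -> forall c : H1X, c = ab0) /\
  (~ cyclic_Sylow -> exists f : H1X -> 'Z_p,
     bijective f /\ {morph f : c d / abD c d >-> c + d}).
Proof.
move=> galH uK galK p_pr sHZ oH H1X cyclic_Sylow.
have [h hE] : exists h, H :=: <[h]>%g.
  by apply/cyclicP/prime_cyclic; rewrite oH.
have oh : #[h]%g = p by rewrite /order -hE.
have hH : h \in H by rewrite hE cycle_id.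
have hC g : commute h g.
  have /centerP[_ hc] : h \in 'Z('Gal({:K} / 1))%g := subsetP sHZ _ hH.
  by apply: hc; rewrite gal_setT inE.
pose Phi (a : {ffun gal_of {:K} -> int}) : char_module K (torus E galE) :=
  torus_char galE a.
have PhiB (a b : {ffun gal_of {:K} -> int}) : Phi (a - b) =
  abD (Phi a) (abN (Phi b)).
  exact: torus_charB.
have Phi_act a s : gact (Phi a) s = Phi (shift s a).
  exact: torus_char_act.
have Phi_surj m : exists a, Phi a = m.
  exact: (torus_char_surj galK).
have Phi_ker a : Phi a = ab0 <-> (forall g,
  a (h * g)%g = a g) /\ \sum_g a g = 0.
  apply: (iff_trans (torus_char_eq0 galK galE a uK)).
  split=> -[ah s0]; split=> //; first by move=> g; apply: ah; rewrite galH.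
  move=> x g; rewrite galH hE => /cycleP[i ->].
  by elim: i => [|i IH]; rewrite ?mul1g // expgS -mulgA ah.
split=> [cyc c|ncyc].
  have [P sylP] := Sylow_exists p 'Gal({:K} / 1)%G.
  have /cyclicP[g Pg] : cyclic P by apply: cyc; rewrite inE.
  (* H is a normal p-subgroup, so it lies in the p-core and in every Sylow p-subgroup. *)
  have : h \in P.
    apply: (subsetP (pcore_sub_Hall sylP)); apply: (subsetP _ _ hH).
    apply: pcore_max; first by rewrite /pgroup oH pnat_id.
    exact: sub_center_normal.
  rewrite Pg => /cycleP[q hq].
  apply: (H1_cyclic p_pr oh hC PhiB Phi_act Phi_surj Phi_ker hq).
  case/and3P: sylP => _ _; rewrite Pg /= gal_setT.
  by rewrite p'natE.
apply: (H1_Zp p_pr oh hC PhiB Phi_act Phi_surj Phi_ker) => x.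
apply/eqP; apply: contra_notT ncyc => xm.
apply: (@cyclic_Sylow_of_expg _ 'Gal({:K} / 1)%G H p x) => //.
- by rewrite /= gal_setT subsetT.
- by rewrite /= gal_setT inE.
by rewrite /= gal_setT hE.
Qed.

Theorem theorem1p1 (k : fieldExtType rat) (K : splittingFieldType k)
    (p : nat) (H : {group gal_of {:K}}) :
  galois 1 {:K} -> prime p ->
  H \subset 'Z('Gal({:K} / 1)) -> #|H| = p ->
  let Kplus : {subfield K} := [aspace of fixedField H] in
  let T := torus Kplus (fixedField_galois H) in
  let H1X := H1 (char_module K T) in
  let cyclic_Sylow := forall P : {group gal_of {:K}},
    P \in 'Syl_p('Gal({:K} / 1)) -> cyclic P in
  (cyclic_Sylow -> forall c : H1X, c = ab0) /\
  (~ cyclic_Sylow -> exists f : H1X -> 'Z_p,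
     bijective f /\ {morph f : c d / abD c d >-> c + d}).
Proof.
move=> galK p_pr sHZ oH Kplus T H1X cyclic_Sylow.
have galH : 'Gal({:K} / Kplus)%g = H := gal_fixedField H.
by apply: (H1_norm_torus _ galH) => //; exact: unit2_infinite_order.
Qed.
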